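(* Let $S$ be a finite set of places of $\mathbb{Q}$ containing the Archimedean place, and let $n\ge1$ and $d_\nu\ge1$ ($\nu\in S$) be integers. Let $\mathbf{U}=\prod_{\nu\in S}U_\nu$, where each $U_\nu\subseteq\mathbb{Q}_\nu^{d_\nu}$ is an open box, and let $\mathbf{f}(\mathbf{x})=(f_\nu(x_\nu))_{\nu\in S}$ for $\mathbf{x}=(x_\nu)_{\nu\in S}\in\mathbf{U}$, where for every $\nu\in S$: (i) $f_\nu=(f_\nu^{(1)},\dots,f_\nu^{(n)}):U_\nu\to\mathbb{Q}_\nu^n$ is an analytic map which can be analytically extended to the boundary of $U_\nu$; (ii) the restrictions of $1,f_\nu^{(1)},\dots,f_\nu^{(n)}$ to any (nonempty) open subset of $U_\nu$ are linearly independent over $\mathbb{Q}_\nu$; (iii) $\|f_\nu(x_\nu)\|_\nu\le 1$ and $\|\nabla f_\nu(x_\nu)\|_\nu\le 1$ for all $x_\nu\in U_\nu$, and $|\bar\Phi_\beta f_\nu|_\nu\le 1/2$ for every second-order difference quotient $\bar\Phi_\beta$ ($|\beta|=2$), at all arguments with points taken in $U_\nu$. Let $\mathcal{R}=\mathbb{Z}_{S_{\mathcal{R}}}$ be a subring of $\mathbb{Z}_S$, where $S_{\mathcal{R}}\subseteq S$ contains the Archimedean place, let $S_{\mathcal{R}}^c=S\setminus S_{\mathcal{R}}$ and $g(\mathcal{R})=|S_{\mathcal{R}}|$. Let $0<\epsilon<\frac{1}{4n|S|(1+|S_{\mathcal{R}}^c|)}$. For $\delta>0$ and positive reals $T_1,\dots,T_n$,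 let $\mathcal{A}$ be the set of all $\mathbf{x}\in\mathbf{U}$ for which there exists $\mathbf{q}=(q_1,\dots,q_n)\in\mathcal{R}^n$ with $\frac{T_i}{2}\le|q_i|_S<T_i$ for all $i$ such that $$|\langle\mathbf{f}(\mathbf{x})\cdot\mathbf{q}\rangle|_S^{|S|}<\delta\Big(\prod_iT_i\Big)^{-g(\mathcal{R})},$$ $$\|\nabla f_\nu(x_\nu)\mathbf{q}\|_\nu>\|\mathbf{q}\|_S^{-\epsilon}\ \text{ for all }\nu\in S_{\mathcal{R}}^c,\qquad \|\nabla f_\nu(x_\nu)\mathbf{q}\|_\nu>\|\mathbf{q}\|_S^{1-\epsilon}\ \text{ for all }\nu\in S_{\mathcal{R}}.$$ Then, for a universal constant $C$ (in particular independent of $\delta$ and of the $T_i$), one has $|\mathcal{A}|<C\,\delta\,|\mathbf{U}|$ whenever $\max_i T_i$ is large enough.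
   Context: Notation. For a place $\nu$ of $\mathbb{Q}$, $\mathbb{Q}_\nu$ is the completion with the usual normalized absolute value $|\cdot|_\nu$ ($\mathbb{Q}_\infty=\mathbb{R}$). Finite-dimensional spaces over $\mathbb{Q}_\nu$ with a standard basis carry the norm $\|\cdot\|_\nu$ which is the Euclidean norm if $\nu=\infty$ and the maximum norm if $\nu$ is finite. $\mathbb{Q}_S=\prod_{\nu\in S}\mathbb{Q}_\nu$; on products $\prod_{\nu\in S}\mathbb{Q}_\nu^{m_\nu}$ one uses $\|\mathbf{x}\|_S=\max_{\nu\in S}\|x_\nu\|_\nu$ (written $|\cdot|_S$ on $\mathbb{Q}_S$). $\mathbb{Q}$ is embedded diagonally in $\mathbb{Q}_S$. $\mathbb{Z}_{S'}$ denotes the ring of $S'$-integers, i.e. the rationals $q$ with $|q|_\nu\le1$ for every $\nu\notin S'$. For $\mathbf{x}\in\mathbb{Q}_S$, $|\langle\mathbf{x}\rangle|=|\langle\mathbf{x}\rangle|_S$ denotes the distance, with respect to $|\cdot|_S$, from $\mathbf{x}$ to $\mathbb{Z}_S$. $\mathbf{f}(\mathbf{x})\cdot\mathbf{q}=(f_\nu(x_\nu)\cdot\mathbf{q})_{\nu\in S}\in\mathbb{Q}_S$, with $x\cdot y=\sum_ix^{(i)}y^{(i)}$. $|\cdot|$ of a set is its measure: Lebesgue measure at $\infty$, Haar measure with $\mu_\nu(\mathbb{Z}_\nu)=1$ at finite $\nu$, and the product measure on $\prod_{\nu\in S}\mathbb{Q}_\nu^{d_\nu}$. Gradient: for a $C^1$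 map $f=(f_1,\dots,f_n)$ from an open subset of $\mathbb{Q}_\nu^{d}$ to $\mathbb{Q}_\nu^n$, $\nabla f(x)$ is the $d\times n$ matrix with $(i,j)$ entry $\partial_i f_j(x)$; $\nabla f(x)\mathbf{q}$ is its product with the column vector $\mathbf{q}$. Difference quotients: for a function $f$ on an open subset $U$ of a local field $F$, $\Phi^0f=f$ and $$\Phi^kf(x_1,\dots,x_{k+1})=\frac{\Phi^{k-1}f(x_1,x_3,\dots,x_{k+1})-\Phi^{k-1}f(x_2,x_3,\dots,x_{k+1})}{x_1-x_2}$$ for pairwise distinct $x_1,\dots,x_{k+1}\in U$. For $f$ on $U_1\times\dots\times U_d$ ($U_i\subseteq F$ open), $\Phi_i^k$ is the $k$-th order difference quotient in the $i$-th coordinate, and for a multi-index $\beta=(i_1,\dots,i_d)$, $\Phi_\beta f=\Phi_1^{i_1}\circ\cdots\circ\Phi_d^{i_d}f$, $|\beta|=\sum_j i_j$. $\bar\Phi_\beta f$ is its (unique) continuous extension to $U_1^{i_1+1}\times\cdots\times U_d^{i_d+1}$, which exists for analytic $f$. For vector-valued $f$ it is applied componentwise.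
   Formalization: The constant C is allowed to depend on n (and on nothing else); a constant independent of n is impossible, e.g. for f(x)=x/√n over the reals with T_1=…=T_{n-1}=1.1 and T_n large, where C must grow like (2/1.1)^n. *)

(* Defs.v *)
From HB Require Import structures.
From mathcomp Require Import all_boot all_order all_algebra.
From mathcomp Require Import finmap ring lra.
From mathcomp Require Import all_classical all_reals all_analysis.
Set Implicit Arguments.
Unset Strict Implicit.
Unset Printing Implicit Defensive.
Import Order.TTheory GRing.Theory Num.Theory.
Import numFieldNormedType.Exports.
Local Open Scope classical_set_scope.
Local Open Scope ring_scope.

Record absval (R : realType) := AbsVal {
  av :> rat -> R;
  av_ge0 : forall x, 0 <= av x;
  av_eq0 : forall x, (av x == 0) = (x == 0);
  avM : forall x y, av (x * y) = av x * av y;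
  av_triangle : forall x y, av (x + y) <= av x + av y }.

Section AbsvalTheory.
Context {R : realType} (a : absval R).

Lemma av0 : a 0 = 0.
Proof. by apply/eqP; rewrite av_eq0. Qed.

Lemma av1 : a 1 = 1.
Proof.
have a10 : a 1 != 0 by rewrite av_eq0 oner_eq0.
by apply: (mulfI a10); rewrite -avM !mulr1.
Qed.

Lemma avN x : a (- x) = a x.
Proof.
have aN1 : a (-1) = 1.
  apply/eqP; rewrite -(@eqrXn2 _ 2) ?av_ge0 //.
  by rewrite expr1n expr2 -avM mulrNN mulr1 av1.
by rewrite -mulN1r avM aN1 mul1r.
Qed.

Lemma avB x y : a (x - y) = a (y - x).
Proof. by rewrite -opprB avN. Qed.

Lemma avV x : a x^-1 = (a x)^-1.
Proof.
have [->|x0] := eqVneq x 0; first by rewrite invr0 av0 invr0.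
have ax0 : a x != 0 by rewrite av_eq0.
by apply: (mulfI ax0); rewrite -avM divff ?divff ?av1.
Qed.

Lemma av_dist x y : `|a x - a y| <= a (x - y).
Proof.
have h u v : a u - a v <= a (u - v).
  by rewrite lerBlDr; have := av_triangle a (u - v) v; rewrite subrK.
by rewrite ler_norml h andbT lerNl opprB avB h.
Qed.

Definition is_cauchy : {pred nat -> rat} := fun u =>
  `[< forall e : R, 0 < e ->
      exists N, forall m n, (N <= m)%N -> (N <= n)%N -> a (u m - u n) < e >].

Lemma is_cauchyP u : reflect (forall e : R, 0 < e ->
  exists N, forall m n, (N <= m)%N -> (N <= n)%N -> a (u m - u n) < e)
  (u \in is_cauchy).
Proof. exact: asboolP. Qed.

Lemma cauchy_bounded u : u \in is_cauchy -> exists2 M, 0 < M & forall n, a (u n) <= M.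
Proof.
move=> /is_cauchyP/(_ 1 ltr01)[N uN].
exists (1 + \sum_(i < N.+1) a (u i)).
  by rewrite ltr_wpDr // sumr_ge0 // => i _; exact: av_ge0.
have le1 k : (k <= N)%N -> a (u k) <= \sum_(i < N.+1) a (u i).
  move=> kN; rewrite (bigD1 (Ordinal (kN : (k < N.+1)%N))) //= lerDl.
  by apply: sumr_ge0 => i _; exact: av_ge0.
move=> n; have [nN|/ltnW Nn] := leqP n N.
  by apply: le_trans (le1 _ nN) _; rewrite lerDr.
have := uN n N Nn (leqnn _) => /ltW h.
rewrite -(subrK (u N) (u n)); apply: le_trans (av_triangle _ _ _) _.
by apply: lerD => //; exact: le1.
Qed.

Lemma is_cauchy_subring : subring_closed is_cauchy.
Proof.
split.
- by apply/is_cauchyP => e e0; exists 0 => m n _ _; rewrite subrr av0.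
- move=> u v /is_cauchyP uC /is_cauchyP vC; apply/is_cauchyP => e e0.
  have e20 : 0 < e / 2 by rewrite divr_gt0.
  have [N1 h1] := uC _ e20; have [N2 h2] := vC _ e20.
  exists (maxn N1 N2) => m n; rewrite !geq_max => /andP[m1 m2] /andP[n1 n2].
  have -> : (u - v) m - (u - v) n = (u m - u n) - (v m - v n).
    by change (u m - v m - (u n - v n) = (u m - u n) - (v m - v n)); ring.
  apply: le_lt_trans (av_triangle _ _ _) _; rewrite avN [e]splitr.
  by rewrite ltrD ?h1 ?h2.
- move=> u v uC vC; apply/is_cauchyP => e e0.
  have [M M0 uM] := cauchy_bounded uC; have [L L0 vL] := cauchy_bounded vC.
  have eM : 0 < e / 2 / M by rewrite !divr_gt0.
  have eL : 0 < e / 2 / L by rewrite !divr_gt0.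
  have [N1 h1] := is_cauchyP _ uC _ eL; have [N2 h2] := is_cauchyP _ vC _ eM.
  exists (maxn N1 N2) => m n; rewrite !geq_max => /andP[m1 m2] /andP[n1 n2].
  have -> : (u * v) m - (u * v) n = u m * (v m - v n) + v n * (u m - u n).
    change (u m * v m - u n * v n = u m * (v m - v n) + v n * (u m - u n)).
    by ring.
  apply: le_lt_trans (av_triangle _ _ _) _; rewrite !avM [e]splitr; apply: ltrD.
    apply: le_lt_trans (ler_wpM2r (av_ge0 _ _) (uM _)) _.
    by rewrite -ltr_pdivlMl // mulrC h2.
  apply: le_lt_trans (ler_wpM2r (av_ge0 _ _) (vL _)) _.
  by rewrite -ltr_pdivlMl // mulrC h1.
Qed.

HB.instance Definition _ :=
  GRing.isSubringClosed.Build (nat -> rat) is_cauchy is_cauchy_subring.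

Record cauchy_seq := CauchySeq {
  cseq_val :> nat -> rat; cseq_valP : cseq_val \in is_cauchy }.

HB.instance Definition _ := [isSub for cseq_val].
HB.instance Definition _ := [Choice of cauchy_seq by <:].
HB.instance Definition _ := [SubChoice_isSubComNzRing of cauchy_seq by <:].

Definition is_null : {pred cauchy_seq} := fun u =>
  `[< forall e : R, 0 < e -> exists N, forall n, (N <= n)%N -> a (u n) < e >].

Lemma is_nullP (u : cauchy_seq) : reflect (forall e : R, 0 < e ->
  exists N, forall n, (N <= n)%N -> a (u n) < e) (u \in is_null).
Proof. exact: asboolP. Qed.

Lemma is_null_ideal : idealr_closed is_null.
Proof.
split.
- by apply/is_nullP => e e0; exists 0 => n _; rewrite [a _]av0.
- apply/negP => /is_nullP/(_ 1 ltr01)[N /(_ N (leqnn _))].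
  by rewrite [a _]av1 ltxx.
- move=> w u v /is_nullP u0 /is_nullP v0; apply/is_nullP => e e0.
  have [M M0 wM] := cauchy_bounded (cseq_valP w).
  have e2 : 0 < e / 2 by rewrite divr_gt0.
  have eM : 0 < e / 2 / M by rewrite !divr_gt0.
  have [N1 h1] := u0 _ eM; have [N2 h2] := v0 _ e2.
  exists (maxn N1 N2) => n; rewrite geq_max => /andP[n1 n2].
  change (a (w n * u n + v n) < e).
  apply: le_lt_trans (av_triangle _ _ _) _; rewrite avM [e]splitr.
  apply: ltrD; last exact: h2.
  apply: le_lt_trans (ler_wpM2r (av_ge0 _ _) (wM _)) _.
  by rewrite -ltr_pdivlMl // mulrC h1.
Qed.

HB.instance Definition _ := isIdealr.Build cauchy_seq is_null is_null_ideal.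

(* The completion of rat for a: Cauchy sequences modulo null sequences. *)
Definition completion := {ideal_quot is_null}.
HB.instance Definition _ := GRing.ComNzRing.on completion.
HB.instance Definition _ := EqQuotient.on completion.

Definition cl : cauchy_seq -> completion := \pi_completion%qT.

Lemma clP (x : completion) : exists u, x = cl u.
Proof. by elim/quotW: x => u; exists u. Qed.

Lemma clE u v : (cl u = cl v) <-> (u - v \in is_null).
Proof.
rewrite Quotient.idealrBE; split=> [/eqP//|/eqP//].
Qed.

Lemma clD u v : cl (u + v) = cl u + cl v. Proof. exact: rmorphD. Qed.
Lemma clM u v : cl (u * v) = cl u * cl v. Proof. exact: rmorphM. Qed.
Lemma clN u : cl (- u) = - cl u. Proof. exact: rmorphN. Qed.
Lemma cl0 : cl 0 = 0. Proof. exact: rmorph0. Qed.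
Lemma cl1 : cl 1 = 1. Proof. exact: rmorph1. Qed.

Lemma cl_eq0 u : (cl u = 0) <-> (u \in is_null).
Proof. by rewrite -cl0 clE subr0. Qed.

Lemma av_cvg (u : cauchy_seq) : cvgn (fun n => a (u n)).
Proof.
apply: cauchy_cvg; apply: cauchy_exP => e e0.
have [N uN] := is_cauchyP _ (cseq_valP u) _ e0.
exists (a (u N)); exists N => // n /= Nn.
by rewrite /ball /=; apply: le_lt_trans (av_dist _ _) _; apply: uN.
Qed.

Lemma av_nonnull (u : cauchy_seq) : u \notin is_null ->
  exists2 c, 0 < c & exists N, forall n, (N <= n)%N -> c <= a (u n).
Proof.
move=> /is_nullP/existsNP[e /not_implyP[e0 /forallNP he]].
have [N uN] := is_cauchyP _ (cseq_valP u) _ (divr_gt0 e0 (ltr0Sn R 1)).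
exists (e / 2); first by rewrite divr_gt0.
have /existsNP[m /not_implyP[Nm /negP]] := he N; rewrite -leNgt => em.
exists N => n Nn.
have := uN m n Nm Nn; have := av_triangle a (u m - u n) (u n).
rewrite subrK => h1 h2; have := le_trans em h1; lra.
Qed.

Lemma cinv_exists (x : completion) : x != 0 -> exists y : completion, y * x = 1.
Proof.
have [u ->] := clP x => u0.
have uN0 : u \notin is_null by apply/negP => /cl_eq0/eqP; rewrite (negbTE u0).
have [c c0 [N0 hc]] := av_nonnull uN0.
have vC : (fun n => (u n)^-1) \in is_cauchy.
  apply/is_cauchyP => e e0.
  have [N1 h1] := is_cauchyP _ (cseq_valP u) _ (mulr_gt0 e0 (mulr_gt0 c0 c0)).
  exists (maxn N0 N1) => m n; rewrite !geq_max => /andP[m0 m1] /andP[n0 n1].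
  have am := hc _ m0; have an := hc _ n0.
  have um0 : u m != 0 by rewrite -(av_eq0 a) gt_eqF // (lt_le_trans c0).
  have un0 : u n != 0 by rewrite -(av_eq0 a) gt_eqF // (lt_le_trans c0).
  have -> : (u m)^-1 - (u n)^-1 = (u n - u m) / (u m * u n) by field; apply/andP.
  rewrite avM avV avM ltr_pdivrMr ?mulr_gt0 ?(lt_le_trans c0) //.
  apply: lt_le_trans (h1 _ _ n1 m1) _; rewrite ler_pM2l //.
  by apply: ler_pM => //; exact: ltW.
exists (cl (CauchySeq vC)); rewrite -clM -cl1; apply/clE/is_nullP => e e0.
exists N0 => n Nn; have an := hc _ Nn.
have un0 : u n != 0 by rewrite -(av_eq0 a) gt_eqF // (lt_le_trans c0).
by change (a ((u n)^-1 * u n - 1) < e); rewrite mulVf // subrr av0.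
Qed.

Definition cinv (x : completion) : completion :=
  if x == 0 then 0 else xget 0 [set y | y * x = 1].

Lemma cmulVx x : x != 0 -> cinv x * x = 1.
Proof.
by move=> x0; rewrite /cinv (negbTE x0); case: xgetP => [y _ //|];
  case: (cinv_exists x0) => y yx /(_ y).
Qed.

Lemma cinv0 : cinv 0 = 0.
Proof. by rewrite /cinv eqxx. Qed.

HB.instance Definition _ := GRing.ComNzRing_isField.Build completion cmulVx cinv0.

Definition cabs (x : completion) : R := limn (fun n => a (repr x n)).

Lemma cabsE (u : cauchy_seq) : cabs (cl u) = limn (fun n => a (u n)).
Proof.
have : cl (repr (cl u)) = cl u by rewrite /cl reprK.
move=> /clE/is_nullP h; rewrite /cabs; set v := repr (cl u).
apply/cvg_lim => //; rewrite -[X in _ --> X]add0r.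
rewrite (_ : (fun n => a (v n)) = fun n => (a (v n) - a (u n)) + a (u n)); last first.
  by apply/funext => n; rewrite subrK.
apply: cvgD; last exact: av_cvg.
apply/cvgrPdist_lt => e e0; have [N hN] := h _ e0; exists N => // n /= Nn.
by rewrite sub0r normrN; apply: le_lt_trans (av_dist _ _) _; exact: hN.
Qed.

Lemma cabs_cvg (u : cauchy_seq) : a (u n) @[n --> \oo] --> cabs (cl u).
Proof. by rewrite cabsE; exact: av_cvg. Qed.

Lemma cabs_ge0 x : 0 <= cabs x.
Proof.
have [u ->] := clP x.
apply: (ler_cvg_to (cvg_cst 0) (@cabs_cvg u)).
by near=> n; exact: av_ge0.
Unshelve. all: by end_near. Qed.

Lemma cabs_eq0 x : (cabs x == 0) = (x == 0).
Proof.
have [u ->] := clP x; apply/eqP/eqP => [u0|/cl_eq0/is_nullP u0].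
  apply/cl_eq0/is_nullP => e e0; have := @cabs_cvg u.
  rewrite u0 => /cvgrPdist_lt/(_ e e0)[N _ h]; exists N => n /h /=.
  by rewrite sub0r normrN ger0_norm ?av_ge0.
rewrite cabsE; apply/cvg_lim => //; apply/cvgrPdist_lt => e e0.
have [N h] := u0 _ e0; exists N => // n /= /h.
by rewrite sub0r normrN ger0_norm ?av_ge0.
Qed.

Lemma cabsM x y : cabs (x * y) = cabs x * cabs y.
Proof.
have [u ->] := clP x; have [v ->] := clP y; rewrite -clM [LHS]cabsE.
apply/cvg_lim => //; under eq_fun do rewrite [a _]avM.
by apply: cvgM; exact: cabs_cvg.
Qed.

Lemma cabs_triangle x y : cabs (x + y) <= cabs x + cabs y.
Proof.
have [u ->] := clP x; have [v ->] := clP y; rewrite -clD.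
apply: (ler_cvg_to (@cabs_cvg _) (cvgD (@cabs_cvg u) (@cabs_cvg v))).
by near=> n; exact: av_triangle.
Unshelve. all: by end_near. Qed.

Lemma cabs_ultra x y :
  (forall p q : rat, a (p + q) <= Num.max (a p) (a q)) ->
  cabs (x + y) <= Num.max (cabs x) (cabs y).
Proof.
move=> aU; have [u ->] := clP x; have [v ->] := clP y; rewrite -clD.
rewrite leNgt; apply/negP; set m := Num.max _ _ => hm.
pose e := (cabs (cl (u + v)) - m) / 2.
have e0 : 0 < e by rewrite divr_gt0 // subr_gt0.
have /cvgrPdist_lt/(_ e e0) h1 := @cabs_cvg u.
have /cvgrPdist_lt/(_ e e0) h2 := @cabs_cvg v.
have /cvgrPdist_lt/(_ e e0) h3 := @cabs_cvg (u + v).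
near \oo => n.
have k1 : `|cabs (cl u) - a (u n)| < e by near: n.
have k2 : `|cabs (cl v) - a (v n)| < e by near: n.
have k3 : `|cabs (cl (u + v)) - a (u n + v n)| < e by near: n.
have um : cabs (cl u) <= m by rewrite /m le_max lexx.
have vm : cabs (cl v) <= m by rewrite /m le_max lexx orbT.
have e2 : e * 2 = cabs (cl (u + v)) - m by rewrite /e divfK.
move: k1 k2 k3 (aU (u n) (v n)); rewrite !ltr_distl.
move=> /andP[k1 _] /andP[k2 _] /andP[_ k3]; rewrite le_max => /orP[]; lra.
Unshelve. all: by end_near. Qed.

Lemma cst_cauchy q : (fun=> q) \in is_cauchy.
Proof. by apply/is_cauchyP => e e0; exists 0 => m n _ _; rewrite subrr av0. Qed.

Definition cst_seq q := CauchySeq (cst_cauchy q).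

Lemma cst_seqB p q : cl (cst_seq (p - q)) = cl (cst_seq p) - cl (cst_seq q).
Proof. by rewrite -clN -clD; congr cl; exact: val_inj. Qed.

Lemma cst_seqM p q : cl (cst_seq (p * q)) = cl (cst_seq p) * cl (cst_seq q).
Proof. by rewrite -clM; congr cl; exact: val_inj. Qed.

Lemma cst_seq1 : cl (cst_seq 1) = 1.
Proof. by rewrite -cl1; congr cl; exact: val_inj. Qed.

Lemma cabs_cst q : cabs (cl (cst_seq q)) = a q.
Proof.
have := @cabs_cvg (cst_seq q).
move=> h; apply/esym; move: h => /(cvg_lim (@Rhausdorff R)) <-.
by rewrite (_ : (fun n => a (cst_seq q n)) = cst (a q)) // lim_cst.
Qed.

Lemma ratr_completion q : ratr q = cl (cst_seq q) :> completion.
Proof.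
have iE (m : int) : cl (cst_seq m%:~R) = m%:~R.
  pose f := fun q => cl (cst_seq q).
  have fB : zmod_morphism f by exact: cst_seqB.
  have fM : monoid_morphism f by split; [exact: cst_seq1|exact: cst_seqM].
  pose f1 := GRing.isZmodMorphism.Build _ _ f fB.
  pose f2 := GRing.isMonoidMorphism.Build _ _ f fM.
  pose F : {rmorphism rat -> completion} := HB.pack f f1 f2.
  exact: (rmorph_int F).
rewrite /ratr -!iE; set d := cl (cst_seq (denq q)%:~R).
have d0 : d != 0 by rewrite -cabs_eq0 cabs_cst av_eq0 intr_eq0 denq_neq0.
apply: (mulIf d0); rewrite divfK // -cst_seqM; congr (cl (cst_seq _)).
exact: numqE.
Qed.

Lemma cabs_ratr q : cabs (ratr q) = a q.
Proof. by rewrite ratr_completion cabs_cst. Qed.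

Lemma completion_dense x (e : R) : 0 < e -> exists q : rat, cabs (x - ratr q) < e.
Proof.
have [u ->] := clP x => e0; have e20 : 0 < e / 2 by rewrite divr_gt0.
have [N uN] := is_cauchyP _ (cseq_valP u) _ e20.
exists (u N); rewrite ratr_completion -clN -clD.
suff : cabs (cl (u - cst_seq (u N))) <= e / 2 by move=> /le_lt_trans->//; lra.
apply: (ler_cvg_to (@cabs_cvg _) (cvg_cst _)).
exists N => // n /= Nn; exact: ltW (uN _ _ Nn (leqnn _)).
Qed.

Lemma completion_complete (x : nat -> completion) :
  (forall e : R, 0 < e -> exists N, forall m n, (N <= m)%N -> (N <= n)%N ->
     cabs (x m - x n) < e) ->
  exists l, forall e : R, 0 < e -> exists N, forall n, (N <= n)%N ->
    cabs (x n - l) < e.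
Proof.
move=> xC.
have cN z : cabs (- z) = cabs z.
  have [w ->] := clP z; rewrite -clN !cabsE.
  by congr (limn _); apply/funext => n; exact: avN.
have /choice[q hq] n : exists q : rat, cabs (x n - ratr q) < n.+1%:R^-1.
  by apply: completion_dense; rewrite invr_gt0.
have small (e : R) : 0 < e -> exists N, forall n, (N <= n)%N -> n.+1%:R^-1 < e.
  move=> e0; have [N _ h] := near_infty_natSinv_lt (PosNum e0).
  by exists N => n /h.
have qC : q \in is_cauchy.
  apply/is_cauchyP => e e0; have e30 : 0 < e / 3 by rewrite divr_gt0.
  have [N1 h1] := xC _ e30; have [N2 h2] := small _ e30.
  exists (maxn N1 N2) => m n; rewrite !geq_max => /andP[m1 m2] /andP[n1 n2].
  have hm := lt_trans (hq m) (h2 _ m2); have hn := lt_trans (hq n) (h2 _ n2).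
  have -> : a (q m - q n) = cabs (- (x m - ratr (q m)) + ((x m - x n) + (x n - ratr (q n)))).
    rewrite -cabs_cst cst_seqB -!ratr_completion; congr cabs; ring.
  apply: le_lt_trans (cabs_triangle _ _) _; rewrite cN.
  have := cabs_triangle (x m - x n) (x n - ratr (q n)).
  have := h1 _ _ m1 n1; lra.
exists (cl (CauchySeq qC)) => e e0; have e20 : 0 < e / 2 by rewrite divr_gt0.
have e40 : 0 < e / 4 by rewrite divr_gt0.
have [N1 h1] := is_cauchyP _ qC _ e40; have [N2 h2] := small _ e20.
exists (maxn N1 N2) => n; rewrite geq_max => /andP[n1 n2].
have -> : x n - cl (CauchySeq qC) = (x n - ratr (q n)) + (ratr (q n) - cl (CauchySeq qC)).
  by ring.
apply: le_lt_trans (cabs_triangle _ _) _.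
have := lt_trans (hq n) (h2 _ n2).
suff : cabs (ratr (q n) - cl (CauchySeq qC)) <= e / 4 by lra.
rewrite ratr_completion -clN -clD.
apply: (ler_cvg_to (@cabs_cvg _) (cvg_cst _)).
by exists N1 => // m /= Nm; exact: ltW (h1 _ _ n1 Nm).
Qed.

End AbsvalTheory.

Section Padic.
Context (R : realType) (p : nat).

Definition padic_norm (q : rat) : R :=
  if q == 0 then 0
  else p%:R ^+ logn p `|denq q|%N / p%:R ^+ logn p `|numq q|%N.

Hypothesis p_prime : prime p.

Let p0 : (p%:R : R) != 0.
Proof. by rewrite pnatr_eq0 -lt0n prime_gt0. Qed.

Let pgt0 : 0 < (p%:R : R).
Proof. by rewrite ltr0n prime_gt0. Qed.

Lemma padic_normE (m d : int) : m != 0 -> d != 0 ->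
  padic_norm (m%:~R / d%:~R) = p%:R ^+ logn p `|d|%N / p%:R ^+ logn p `|m|%N.
Proof.
move=> m0 d0; set q := m%:~R / d%:~R.
have q0 : q != 0 by rewrite mulf_neq0 ?invr_eq0 ?intr_eq0.
rewrite /padic_norm (negbTE q0).
apply/eqP; rewrite eqr_div ?expf_neq0 // -!exprD.
suff -> : (logn p `|denq q| + logn p `|m| = logn p `|d| + logn p `|numq q|)%N by [].
have nq0 : numq q != 0 by rewrite numq_eq0.
rewrite -!lognM ?absz_gt0 ?denq_neq0 // -!abszM; congr (logn p `|_|%N).
apply/eqP; rewrite -(eqr_int rat) !intrM mulrC [eqbRHS]mulrC -eqr_div ?intr_eq0 ?denq_neq0 //.
by rewrite divq_num_den.
Qed.

Lemma padic_norm0 : padic_norm 0 = 0.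
Proof. by rewrite /padic_norm eqxx. Qed.

Lemma padic_norm_gt0 q : q != 0 -> 0 < padic_norm q.
Proof. by move=> /negbTE q0; rewrite /padic_norm q0 divr_gt0 ?exprn_gt0. Qed.

Lemma padic_norm_ge0 q : 0 <= padic_norm q.
Proof.
by have [->|/padic_norm_gt0/ltW//] := eqVneq q 0; rewrite padic_norm0.
Qed.

Lemma padic_norm_eq0 q : (padic_norm q == 0) = (q == 0).
Proof.
have [->|q0] := eqVneq q 0; first by rewrite padic_norm0 eqxx.
by rewrite gt_eqF // padic_norm_gt0.
Qed.

Lemma padic_normM x y : padic_norm (x * y) = padic_norm x * padic_norm y.
Proof.
have [->|x0] := eqVneq x 0; first by rewrite mul0r padic_norm0 mul0r.
have [->|y0] := eqVneq y 0; first by rewrite mulr0 padic_norm0 mulr0.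
rewrite -(divq_num_den x) -(divq_num_den y) mulf_div -!intrM.
rewrite !padic_normE ?mulf_neq0 ?numq_eq0 ?denq_neq0 //.
by rewrite !abszM !lognM ?absz_gt0 ?numq_eq0 ?denq_neq0 // !exprD -mulf_div.
Qed.

Lemma padic_norm_ultra x y :
  padic_norm (x + y) <= Num.max (padic_norm x) (padic_norm y).
Proof.
have [->|x0] := eqVneq x 0; first by rewrite add0r le_max lexx orbT.
have [->|y0] := eqVneq y 0; first by rewrite addr0 le_max lexx.
have [->|xy0] := eqVneq (x + y) 0; first by rewrite padic_norm0 le_max padic_norm_ge0.
pose A := numq x * denq y; pose B := numq y * denq x; pose D := denq x * denq y.
have D0 : D != 0 by rewrite mulf_neq0 ?denq_neq0.
have A0 : A != 0 by rewrite mulf_neq0 ?numq_eq0 ?denq_neq0.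
have B0 : B != 0 by rewrite mulf_neq0 ?numq_eq0 ?denq_neq0.
have dx0 : (denq x)%:~R != 0 :> rat by rewrite intr_eq0 denq_neq0.
have dy0 : (denq y)%:~R != 0 :> rat by rewrite intr_eq0 denq_neq0.
have xE : x = A%:~R / D%:~R.
  by rewrite -[LHS]divq_num_den !intrM -mulf_div divff ?mulr1.
have yE : y = B%:~R / D%:~R.
  by rewrite /D (mulrC (denq x)) -[LHS]divq_num_den !intrM -mulf_div divff ?mulr1.
have xyE : x + y = (A + B)%:~R / D%:~R by rewrite {1}xE {1}yE -mulrDl intrD.
have AB0 : A + B != 0.
  by apply: contraNneq xy0; rewrite xyE => ->; rewrite mul0r.
rewrite xyE xE yE !padic_normE //.
set k := minn (logn p `|A|%N) (logn p `|B|%N).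
have kAB : (k <= logn p `|(A + B)%R|)%N.
  rewrite -pfactor_dvdn ?absz_gt0 //.
  have : (Posz (p ^ k)%N %| (A + B)%R)%Z.
    by rewrite rpredD // dvdzE /= pfactor_dvdn ?absz_gt0 // ?geq_minl ?geq_minr.
  by rewrite dvdzE.
have : p%:R ^+ logn p `|D|%N / p%:R ^+ logn p `|(A + B)%R|%N <=
       p%:R ^+ logn p `|D|%N / p%:R ^+ k :> R.
  rewrite ler_pM2l ?exprn_gt0 // lef_pV2 ?posrE ?exprn_gt0 //.
  by rewrite ler_weXn2l // ler1n prime_gt0.
move=> /le_trans; apply; rewrite /k; case: leqP => _; rewrite le_max lexx ?orbT //.
Qed.

Lemma padic_norm_triangle x y : padic_norm (x + y) <= padic_norm x + padic_norm y.
Proof.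
apply: le_trans (padic_norm_ultra _ _) _.
by rewrite ge_max lerDl lerDr !padic_norm_ge0.
Qed.

Definition padic_absval : absval R :=
  AbsVal padic_norm_ge0 padic_norm_eq0 padic_normM padic_norm_triangle.

End Padic.

(* A place of Q: None is the Archimedean place, Some p the place of the prime p. *)
Definition place := option {p : nat | prime p}.

Definition place_abs (R : realType) (v : place) (q : rat) : R :=
  match v with
  | None => `|ratr q|
  | Some p => padic_norm R (val p) q
  end.

Definition Qv (R : realType) (v : place) : fieldType :=
  match v with
  | None => R
  | Some p => completion (padic_absval R (valP p))
  end.

Definition absv (R : realType) (v : place) : Qv R v -> R :=
  match v return Qv R v -> R with
  | None => fun x : R => `|x|
  | Some p => @cabs R (padic_absval R (valP p))
  end.

Section QvTheory.
Context {R : realType} {v : place}.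
Implicit Types x y : Qv R v.

Lemma absv_ge0 x : 0 <= absv x.
Proof. by case: v x => [p|] x; [exact: cabs_ge0|exact: normr_ge0]. Qed.

Lemma absv_eq0 x : (absv x == 0) = (x == 0).
Proof. by case: v x => [p|] x; [exact: cabs_eq0|exact: normr_eq0]. Qed.

Lemma absvM x y : absv (x * y) = absv x * absv y.
Proof. by case: v x y => [p|] x y; [exact: cabsM|exact: normrM]. Qed.

Lemma absv_triangle x y : absv (x + y) <= absv x + absv y.
Proof. by case: v x y => [p|] x y; [exact: cabs_triangle|exact: ler_normD]. Qed.

Lemma absv_ratr q : absv (ratr q : Qv R v) = place_abs R v q.
Proof. by case: v => [p|] //; exact: cabs_ratr. Qed.

Lemma absv_ultra x y : v != None -> absv (x + y) <= Num.max (absv x) (absv y).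
Proof.
case: v x y => [p|//] x y _ /=.
apply: cabs_ultra => *; exact: padic_norm_ultra (valP p) _ _.
Qed.

Lemma Qv_dense x (e : R) : 0 < e -> exists q : rat, absv (x - ratr q) < e.
Proof.
case: v x => [p|] x e0; first exact: completion_dense.
have [q /andP[]] : exists q : rat, x - e < ratr q < x + e.
  have /rat_in_itvoo[q] : x - e < x + e by rewrite ltrD2l gtrN.
  by rewrite in_itv /=; exists q.
by exists q; rewrite /= ltr_norml; apply/andP; split; lra.
Qed.

Lemma Qv_complete (x : nat -> Qv R v) :
  (forall e : R, 0 < e -> exists N, forall m n, (N <= m)%N -> (N <= n)%N ->
     absv (x m - x n) < e) ->
  exists l, forall e : R, 0 < e -> exists N, forall n, (N <= n)%N ->
    absv (x n - l) < e.
Proof.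
case: v x => [p|] x xC; first exact: completion_complete.
have xl : cvgn (x : nat -> R).
  apply: cauchy_cvg; apply: cauchy_exP => e e0.
  have [N xN] := xC e e0; exists (x N); exists N => // n /= Nn.
  exact: xN (leqnn _) Nn.
exists (limn (x : nat -> R)) => e e0.
have /cvgrPdist_lt/(_ e e0)[N _ h] : x n @[n --> \oo] --> limn (x : nat -> R) by [].
by exists N => n /h; rewrite /= distrC.
Qed.

End QvTheory.

Section Spaces.
Variable R : realType.

(* Euclidean norm at the Archimedean place, maximum norm at the finite ones. *)
Definition normv (v : place) m n (A : 'M[Qv R v]_(m, n)) : R :=
  if v is None then Num.sqrt (\sum_i \sum_j absv (A i j) ^+ 2)
  else \big[Num.max/0]_i \big[Num.max/0]_j absv (A i j).

Definition oball (v : place) (c : Qv R v) (r : R) : set (Qv R v) :=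
  [set x | absv (x - c) < r].

(* A box is a bounded product of open balls; over R, of open intervals. *)
Definition obox (v : place) d (c : 'rV[Qv R v]_d) (r : 'I_d -> R) :
  set 'rV[Qv R v]_d := [set x | forall i, oball (c 0 i) (r i) (x 0 i)].

Definition openv (v : place) d (A : set 'rV[Qv R v]_d) : Prop :=
  forall x, A x -> exists2 r : R, 0 < r & forall y, normv (y - x) < r -> A y.

Definition closurev (v : place) d (A : set 'rV[Qv R v]_d) : set 'rV[Qv R v]_d :=
  [set x | forall r : R, 0 < r -> exists2 y, A y & normv (y - x) < r].

Section LocalFunctions.
Context {v : place}.
Local Notation K := (Qv R v).

(* Unconditional summability (limit over the finite subsets of the index type):
   absolute convergence over the reals, terms tending to zero over Q_p. *)
Definition has_sumv (I : choiceType) n (F : I -> 'rV[K]_n) (s : 'rV[K]_n) : Prop :=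
  forall e : R, 0 < e -> exists A0 : {fset I}, forall A : {fset I},
    (A0 `<=` A)%fset -> normv (\sum_(i <- A) F i - s) < e.

Definition analytic_at d n (f : 'rV[K]_d -> 'rV[K]_n) (x0 : 'rV[K]_d) : Prop :=
  exists (r : R) (c : {ffun 'I_d -> nat} -> 'rV[K]_n), 0 < r /\
    forall x, normv (x - x0) < r ->
      has_sumv (fun a : {ffun 'I_d -> nat} =>
        (\prod_i (x - x0) 0 i ^+ a i) *: c a) (f x).

Definition analytic_on d n (W : set 'rV[K]_d) (f : 'rV[K]_d -> 'rV[K]_n) : Prop :=
  forall x, W x -> analytic_at f x.

Definition extends_to_boundary d n (U : set 'rV[K]_d)
    (f : 'rV[K]_d -> 'rV[K]_n) : Prop :=
  exists (W : set 'rV[K]_d) (g : 'rV[K]_d -> 'rV[K]_n),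
    [/\ openv W, closurev U `<=` W, analytic_on W g & {in U, f =1 g}].

Definition is_partial d (f : 'rV[K]_d -> K) (i : 'I_d) (x : 'rV[K]_d) (l : K) : Prop :=
  forall e : R, 0 < e -> exists2 r : R, 0 < r & forall h : K, h != 0 ->
    absv h < r -> absv ((f (x + h *: delta_mx 0 i) - f x) / h - l) < e.

Definition partial d (f : 'rV[K]_d -> K) (i : 'I_d) (x : 'rV[K]_d) : K :=
  xget 0 [set l | is_partial f i x l].

Definition gradient d n (f : 'rV[K]_d -> 'rV[K]_n) (x : 'rV[K]_d) : 'M[K]_(d, n) :=
  \matrix_(i, j) partial (fun y => f y 0 j) i x.

(* dq k g x is Phi^k g (x 0, ..., x k). The index shift [bump 1] drops x 1,
   and [bump 0] drops x 0. *)
Fixpoint dq (k : nat) (g : K -> K) (x : nat -> K) : K :=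
  if k is k'.+1 then
    (dq k' g (x \o bump 1) - dq k' g (x \o bump 0)) / (x 0%N - x 1%N)
  else g (x 0%N).

(* The arguments of Phi_beta f are stored as y : 'I_d -> nat -> K, where y j k is
   the k-th point in the j-th coordinate; only the entries with k <= beta j matter. *)
Definition dq_coord d (j : 'I_d) (k : nat) (F : ('I_d -> nat -> K) -> K)
    (y : 'I_d -> nat -> K) : K :=
  dq k (fun t => F (fun i => if i == j then fun=> t else y i)) (y j).

Definition dq_multi d (beta : 'I_d -> nat) (f : 'rV[K]_d -> K) :
    ('I_d -> nat -> K) -> K :=
  foldr (fun j F => dq_coord j (beta j) F) (fun y => f (\row_j y j 0%N)) (enum 'I_d).

Definition dq_dom d (U : 'I_d -> set K) (beta : 'I_d -> nat) : set ('I_d -> nat -> K) :=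
  [set y | forall j k, (k <= beta j)%N -> U j (y j k)].

Definition dq_distinct d (beta : 'I_d -> nat) : set ('I_d -> nat -> K) :=
  [set y | forall j k l, (k < l)%N -> (l <= beta j)%N -> y j k != y j l].

(* G is a continuous extension of Phi_beta f to all arguments with points in U. *)
Definition is_dq_extension d (U : 'I_d -> set K) (beta : 'I_d -> nat)
    (f : 'rV[K]_d -> K) (G : ('I_d -> nat -> K) -> K) : Prop :=
  (forall y, dq_dom U beta y -> dq_distinct beta y -> G y = dq_multi beta f y) /\
  (forall y, dq_dom U beta y -> forall e : R, 0 < e -> exists2 r : R, 0 < r &
     forall y', dq_dom U beta y' ->
       (forall j k, (k <= beta j)%N -> absv (y' j k - y j k) < r) ->
       absv (G y' - G y) < e).

Definition independent_with_1 d n (U : set 'rV[K]_d)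
    (f : 'rV[K]_d -> 'rV[K]_n) : Prop :=
  forall V : set 'rV[K]_d, openv V -> V !=set0 -> V `<=` U ->
  forall (a0 : K) (a : 'cV[K]_n),
    (forall x, V x -> a0 + (f x *m a) 0 0 = 0) -> a0 = 0 /\ a = 0.

(* A vector of rationals, seen as a column vector over K. *)
Definition qcol n (q : 'I_n -> rat) : 'cV[K]_n := \col_i ratr (q i).

End LocalFunctions.

(* Z_S, as a set of rationals. *)
Definition S_integer (S : {fset place}) : set rat :=
  [set q | forall v : place, v \notin S -> place_abs R v q <= 1].

Section SArithmetic.
Variable S : {fset place}.

(* |q|_S for a rational q embedded diagonally, and ||q||_S for a rational vector. *)
Definition absS (q : rat) : R := \big[Num.max/0]_(v : S) place_abs R (val v) q.

Definition normS n (q : 'I_n -> rat) : R :=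
  \big[Num.max/0]_(v : S) normv (@qcol (val v) n q).

(* The distance from y in Q_S to Z_S. *)
Definition dist_ZS (y : forall v : S, Qv R (val v)) : R :=
  inf [set \big[Num.max/0]_(v : S) absv (y v - ratr z) | z in S_integer S].

Variable d : S -> nat.

Definition QSpace : Type := forall v : S, 'rV[Qv R (val v)]_(d v).

HB.instance Definition _ := gen_eqMixin QSpace.
HB.instance Definition _ := gen_choiceMixin QSpace.
HB.instance Definition _ := isPointed.Build QSpace (fun=> 0).

Definition QSpace_open (A : set QSpace) : Prop :=
  forall x, A x -> exists2 r : R, 0 < r &
    forall y : QSpace, (forall v, normv (y v - x v) < r) -> A y.

(* QSpace with its Borel sigma-algebra. *)
Definition QSpace_borel := g_sigma_algebraType [set A | QSpace_open A].

End SArithmetic.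

(* The carrier of Qv, as a bare pointed type. *)
Definition Qv_space (v : place) : Type := Qv R v.

HB.instance Definition _ v := Choice.on (Qv_space v).
HB.instance Definition _ v := isPointed.Build (Qv_space v) (0 : Qv R v).

Definition Qv_open v (A : set (Qv R v)) : Prop :=
  forall x, A x -> exists2 r : R, 0 < r & oball x r `<=` A.

Definition Qv_borel v := g_sigma_algebraType [set A : set (Qv_space v) | Qv_open A].

(* Lebesgue measure on Q_oo = R; at a finite place, the Haar measure that gives
   the ring of integers mass 1. *)
Definition is_mu_v (v : place) : {measure set (Qv_borel v) -> \bar R} -> Prop :=
  match v with
  | None => fun mu => forall A : set (Qv_borel None), measurable A ->
      mu A = lebesgue_measure (A : set R)
  | Some p => fun mu =>
      (forall (A : set (Qv_borel (Some p))) (t : Qv R (Some p)), measurable A ->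
         mu [set (x : Qv R (Some p)) + t | x in A] = mu A) /\
      mu [set x : Qv R (Some p) | absv x <= 1] = 1%E
  end.

Definition is_product_measure (S : {fset place}) (d : S -> nat)
    (mu_ : forall v : S, {measure set (Qv_borel (val v)) -> \bar R})
    (mu : {measure set (QSpace_borel d) -> \bar R}) : Prop :=
  forall A : forall v : S, 'I_(d v) -> set (Qv_borel (val v)),
    (forall v i, measurable (A v i)) ->
    mu [set x : QSpace d | forall v i, A v i (x v 0 i)] =
      (\prod_(v : S) \prod_(i < d v) mu_ v (A v i))%E.

End Spaces.

Arguments qcol {R v n} q.

(* Main.v *)
(* Sum over q. For one q write F_v = f_v . q, let N = ||q||_S and H_v = N or 1
   according to whether v lies in S_R. The second difference quotients bound the
   variation of the partial derivatives of F_v by a multiple of H_v, while the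
   gradient exceeds H_v N^-eps; hence on a box of side about N^-eps some coordinate
   direction i_v has |d_i F_v| = a_v up to a factor 2 (exactly, at finite places).
   Cut such a box into slabs that are very thin in all other coordinates, with side
   w_v in the direction i_v. On a slab F_v is almost affine in one variable: the
   S-integers z that come close to its values are O(prod_v a_v w_v) in number, since
   this product is large when N is, and each of them confines x to a sub-box of
   relative volume O(prod_v e/(a_v w_v)), with e^|S| = delta (prod T_i)^-g. So the
   strip of q has relative measure O(e^|S|). There are at most 3^n (prod T_i)^g
   vectors q. All losses occur at the real place only, which makes the constant
   independent of S. *)
Require Import Defs.
From HB Require Import structures.
From mathcomp Require Import all_boot all_order all_algebra.
From mathcomp Require Import finmap ring lra.
From mathcomp Require Import all_classical all_reals all_analysis.
Set Implicit Arguments.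
Unset Strict Implicit.
Unset Printing Implicit Defensive.
Import Order.TTheory GRing.Theory Num.Theory.
Import numFieldNormedType.Exports.
Local Open Scope classical_set_scope.
Local Open Scope ring_scope.

(** * Absolute values on the completions *)

(** As soon as [S] has two places, the S-integers are dense in every single completion, so no count
    of the relevant [z] is possible one place at a time: only the simultaneous constraints at all
    places of [S] leave finitely many, and their number is governed by the product of the radii
    alone. Hence one slab is a product over all of [S]. The product of the [a_v w_v] enters the
    count of the [z] and, inverted, the relative volume that each [z] allows; these cancel, and
    nothing has to be balanced between the places. The count also has a summand 1, which is harmless
    only if that product is at least 1. With sides of order N^-eps one has a_v w_v at least k0 H_v
    N^(-2 eps), and the product of the H_v is at least N because the real place lies in S_R. Thus
    the product is at least k0^|S| N^(1 - 2 eps |S|), and eps |S| <= 1/4 leaves a factor N^(1/2) to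
    beat the constants. The same estimate shows that e is below every a_v w_v. *)

Section Absv.
Context {R : realType} {v : place}.
Implicit Types x y z : Qv R v.

Lemma absv0 : absv (0 : Qv R v) = 0.
Proof. by apply/eqP; rewrite absv_eq0. Qed.

Lemma absv_gt0 x : (0 < absv x) = (x != 0).
Proof. by rewrite lt_def absv_ge0 andbT absv_eq0. Qed.

Lemma absv1 : absv (1 : Qv R v) = 1.
Proof.
have a10 : absv (1 : Qv R v) != 0 by rewrite absv_eq0 oner_eq0.
by apply: (mulfI a10); rewrite -absvM !mulr1.
Qed.

Lemma absvN x : absv (- x) = absv x.
Proof.
have aN1 : absv (-1 : Qv R v) = 1.
  apply/eqP; rewrite -(@eqrXn2 _ 2) ?absv_ge0 //.
  by rewrite expr1n expr2 -absvM mulrNN mulr1 absv1.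
by rewrite -mulN1r absvM aN1 mul1r.
Qed.

Lemma absvB x y : absv (x - y) = absv (y - x).
Proof. by rewrite -opprB absvN. Qed.

Lemma absv_split y x z : absv (x - z) <= absv (x - y) + absv (y - z).
Proof. by apply: le_trans (absv_triangle _ _); rewrite addrA subrK. Qed.

Lemma absv_subD x y : absv (x - y) <= absv x + absv y.
Proof. by rewrite -(absvN y); exact: absv_triangle. Qed.

Lemma absv_lerB x y : absv x - absv y <= absv (x - y).
Proof. by rewrite lerBlDr; apply: le_trans (absv_triangle _ _); rewrite subrK. Qed.

Lemma absvV x : absv x^-1 = (absv x)^-1.
Proof.
have [->|x0] := eqVneq x 0; first by rewrite invr0 absv0 invr0.
have ax0 : absv x != 0 by rewrite absv_eq0.
by apply: (mulfI ax0); rewrite -absvM !divff ?absv1.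
Qed.

Lemma absv_sum (I : Type) (s : seq I) (P : pred I) (F : I -> Qv R v) :
  absv (\sum_(i <- s | P i) F i) <= \sum_(i <- s | P i) absv (F i).
Proof.
elim/big_rec2: _ => [|i a b _ h]; first by rewrite absv0.
by apply: le_trans (absv_triangle _ _) _; rewrite lerD2l.
Qed.

Lemma ratr_QvB p q : ratr (p - q) = ratr p - ratr q :> Qv R v.
Proof.
case: v => [l|]; last exact: (rmorphB (@ratr R)).
by rewrite !ratr_completion cst_seqB.
Qed.

End Absv.

(** * Arithmetic of the p-adic norm on the rationals *)

Section Padic.
Context (R : realType) (p : nat) (pp : prime p).

Lemma padic_norm1 : padic_norm R p 1 = 1.
Proof. exact: (av1 (padic_absval R pp)). Qed.

Lemma padic_normV q : padic_norm R p q^-1 = (padic_norm R p q)^-1.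
Proof. exact: (avV (padic_absval R pp)). Qed.

Lemma padic_normXz q (k : int) : padic_norm R p (q ^ k) = padic_norm R p q ^ k.
Proof.
have hX (n : nat) : padic_norm R p (q ^+ n) = padic_norm R p q ^+ n.
  elim: n => [|n IH]; first by rewrite !expr0 padic_norm1.
  by rewrite !exprS padic_normM // IH.
case: k => n; first exact: hX.
by rewrite !NegzE -!exprnN padic_normV hX.
Qed.

Lemma padic_norm_intE (m : int) : m != 0 ->
  padic_norm R p m%:~R = (p%:R ^+ logn p `|m|%N)^-1.
Proof.
by move=> m0; have := padic_normE R pp m0 (oner_neq0 _); rewrite divr1 logn1 expr0 div1r.
Qed.

Lemma padic_norm_int (m : int) : padic_norm R p m%:~R <= 1.
Proof.
have [->|m0] := eqVneq m 0; first by rewrite padic_norm0.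
by rewrite padic_norm_intE // invf_le1 ?exprn_ege1 ?exprn_gt0 ?ler1n ?ltr0n ?prime_gt0.
Qed.

Lemma padic_norm_prime (l : nat) : prime l ->
  padic_norm R p l%:R = if l == p then p%:R^-1 else 1.
Proof.
move=> pl; have l0 : l%:Z != 0 by rewrite eqz_nat -lt0n prime_gt0.
by rewrite (padic_norm_intE l0) logn_prime // eq_sym; case: eqP => _; rewrite ?expr1 ?expr0 ?invr1.
Qed.

Lemma padic_norm_value q : q != 0 -> exists k : int, padic_norm R p q = p%:R ^ k.
Proof.
move=> /negbTE q0; rewrite /padic_norm q0.
exists ((logn p `|denq q|%N)%:Z - (logn p `|numq q|%N)%:Z).
by rewrite expfzDr -?exprnN // pnatr_eq0 -lt0n prime_gt0.
Qed.

(* Reduce the numerator of [q] modulo [p] after inverting its denominator. *)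
Lemma padic_residue q : padic_norm R p q <= 1 ->
  exists2 i, (i < p)%N & padic_norm R p (q - i%:R) <= p%:R^-1.
Proof.
have p0 := prime_gt0 pp; move=> q1.
(* If [p] divided the denominator, it would not divide the numerator, and the norm of [q] would
   exceed 1. *)
have cpd : coprime `|denq q| p.
  rewrite coprime_sym prime_coprime //; apply/negP => pd.
  have q0 : q != 0.
    apply: contraTneq pd => ->; rewrite (denq_int 0).
    by rewrite gtnNdvd // prime_gt1.
  have cn : coprime p `|numq q|.
    by apply: coprime_dvdl pd _; rewrite coprime_sym; exact: coprime_num_den.
  move: q1; rewrite -{1}[q]divq_num_den padic_normE ?numq_eq0 ?denq_neq0 //.
  rewrite (lognE p `|numq q|).
  have -> : (p %| `|numq q|)%N = false by move: cn; rewrite prime_coprime // => /negbTE.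
  rewrite !andbF expr0 divr1 leNgt => /negP; apply.
  by rewrite exprn_egt1 ?ltr1n ?prime_gt1 // lognE pp pd absz_gt0 denq_neq0.
have [u hu] : exists u : int, (p %| (denq q * u - 1))%Z.
  have [u [w h]] := Bezoutz (denq q) p.
  have g1 : gcdz (denq q) p = 1 by rewrite /gcdz (eqP cpd).
  exists u; rewrite -(rpredN _) opprB; apply/dvdzP; exists w.
  by move: h; rewrite g1 => <-; ring.
pose i := ((u * numq q) %% p)%Z.
have i0 : 0 <= i by rewrite modz_ge0 // eqz_nat -lt0n.
have ip : i < p by rewrite ltz_pmod // ltz_nat.
have iE : i = `|i|%N by rewrite gez0_abs.
exists `|i|%N; first by rewrite -ltz_nat -iE.
have -> : (`|i|%N%:R : rat) = i%:~R by rewrite {2}iE.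
have dvd : (p %| (numq q - i * denq q))%Z.
  have iD : i = u * numq q - (u * numq q %/ p)%Z * p%:Z.
    by apply/eqP; rewrite eq_sym subr_eq [i + _]addrC; apply/eqP; exact: divz_eq.
  have -> : numq q - i * denq q =
     - (numq q * (denq q * u - 1)) + p%:Z * ((u * numq q %/ p)%Z * denq q).
    by rewrite iD; ring.
  by apply: rpredD; [rewrite rpredN; exact: dvdz_mull|exact: dvdz_mulr].
have [c hc] := dvdzP dvd.
have dq0 : (denq q)%:~R != 0 :> rat by rewrite intr_eq0 denq_neq0.
have -> : q - i%:~R = (c%:~R * p%:R) / (denq q)%:~R.
  rewrite -{1}[q]divq_num_den; apply: (mulIf dq0); rewrite mulrBl !divfK //.
  by rewrite -intrM -[p%:R]/(p%:~R) -intrM -hc intrB.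
rewrite padic_normM // padic_normV padic_normM // padic_norm_prime //.
have -> : padic_norm R p (denq q)%:~R = 1.
  rewrite padic_norm_intE ?denq_neq0 // lognE. have -> : (p %| `|denq q|)%N = false; last by rewrite !andbF expr0 invr1.
  by move: cpd; rewrite coprime_sym prime_coprime // => /negbTE.
by rewrite eqxx invr1 mulr1 ler_piMl ?padic_norm_int // invr_ge0.
Qed.

End Padic.

(** A prime divisor of a nontrivial denominator does not divide the numerator, so the norm at that
    prime would exceed 1. *)
Lemma padic_integer_int (R : realType) (q : rat) :
  (forall p, prime p -> padic_norm R p q <= 1) -> exists m : int, q = m%:~R.
Proof.
move=> h; exists (numq q).
suff d1 : denq q = 1 by rewrite -{1}[q]divq_num_den d1 divr1.
apply/eqP; apply: contraT => d1.
have dgt1 : (1 < `|denq q|)%N.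
  by rewrite -ltz_nat gez0_abs ?denq_ge0 // lt_def d1 -gtz0_ge1 denq_gt0.
have pp := pdiv_prime dgt1; set p := pdiv _ in pp; have pd := pdiv_dvd `|denq q|.
have q0 : q != 0 by apply: contraNneq d1 => ->; rewrite (denq_int 0).
have cn : coprime p `|numq q|.
  by apply: coprime_dvdl pd _; rewrite coprime_sym; exact: coprime_num_den.
have := h p pp; rewrite -{1}[q]divq_num_den padic_normE ?numq_eq0 ?denq_neq0 //.
rewrite (lognE p `|numq q|).
have -> : (p %| `|numq q|)%N = false by move: cn; rewrite prime_coprime // => /negbTE.
rewrite !andbF expr0 divr1 leNgt => /negP[].
by rewrite exprn_egt1 ?ltr1n ?prime_gt1 // lognE pp pd absz_gt0 denq_neq0.
Qed.

(** * Balls: splitting, counting, measure *)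

(* Radii are taken in the value group, so that at a finite place the Haar measure of
   a closed ball is exactly its radius. *)
Definition value_radius (R : realType) (v : place) (w : R) : Prop :=
  match v with
  | None => 0 < w
  | Some p => exists k : int, w = (val p)%:R ^ k
  end.

(** The number of pieces into which a ball is cut in one refinement: residue classes at a prime,
    halves over the reals. The radius shrinks by the same factor, so the volumes of the pieces add
    up exactly. *)
Definition place_base (v : place) : nat := if v is Some p then val p else 2.

Lemma place_base_gt1 v : (1 < place_base v)%N.
Proof. by case: v => [[p pp]|] //=; exact: prime_gt1. Qed.

Section Radius.
Context {R : realType}.
Implicit Type v : place.

Lemma place_base_gt0 v : 0 < (place_base v)%:R :> R.
Proof. by rewrite ltr0n ltnW // place_base_gt1. Qed.

Lemma value_radius_gt0 v (w : R) : value_radius v w -> 0 < w.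
Proof.
case: v => [p|] //= [k ->]; apply: exprz_gt0.
by rewrite ltr0n prime_gt0 // (valP p).
Qed.

Lemma value_radiusM v (w w' : R) :
  value_radius v w -> value_radius v w' -> value_radius v (w * w').
Proof.
case: v => [p|] /=; last exact: mulr_gt0.
move=> [k ->] [k' ->]; exists (k + k').
by rewrite expfzDr // pnatr_eq0 -lt0n prime_gt0 // (valP p).
Qed.

Lemma value_radiusV v (w : R) : value_radius v w -> value_radius v w^-1.
Proof.
case: v => [p|] /=; first by move=> [k ->]; exists (- k); rewrite invr_expz.
by rewrite invr_gt0.
Qed.

Lemma value_radius1 v : value_radius v (1 : R).
Proof. by case: v => [p|] /=; [exists 0; rewrite expr0z|exact: ltr01]. Qed.

Lemma value_radius_base v : value_radius v ((place_base v)%:R : R).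
Proof. by case: v => [p|] /=; [exists 1; rewrite expr1z|exact: ltr0Sn]. Qed.

Lemma value_radiusX v (w : R) n : value_radius v w -> value_radius v (w ^+ n).
Proof.
move=> h; elim: n => [|n IH]; first by rewrite expr0; exact: value_radius1.
by rewrite exprS; exact: value_radiusM.
Qed.

Lemma value_radius_divX v (w : R) n :
  value_radius v w -> value_radius v (w / (place_base v)%:R ^+ n).
Proof.
move=> h; apply: value_radiusM => //; apply: value_radiusV; apply: value_radiusX.
exact: value_radius_base.
Qed.

(** By the ultrametric inequality a rational closer to [x] than [absv x] has the same absolute
    value, so completing adds no new values. *)
Lemma value_radius_absv v (x : Qv R v) : x != 0 -> value_radius v (absv x).
Proof.
case: v x => [p|] x x0; last by rewrite /= normr_gt0.
have ax : 0 < absv x by rewrite absv_gt0.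
have [q hq] := Qv_dense x ax.
have aE : absv x = absv (ratr q : Qv R (Some p)).
  apply/eqP; rewrite eq_le; apply/andP; split.
    have := @absv_ultra R (Some p) (x - ratr q) (ratr q) isT; rewrite subrK.
    by rewrite le_max leNgt hq.
  have := @absv_ultra R (Some p) (ratr q - x) x isT.
  by rewrite subrK (absvB (ratr q)) => /le_trans -> //; rewrite ge_max lexx (ltW hq).
rewrite aE absv_ratr /=; apply: padic_norm_value; first exact: valP.
by apply: contraTneq ax => q0; rewrite aE absv_ratr q0 /= padic_norm0 ltxx.
Qed.

(** At a finite place [w] is the largest power of the prime strictly below [T], so the open ball of
    radius [T] is the closed ball of radius [w]. Over the reals [w] is [T] itself. *)
Lemma floor_radius v (T : R) : 0 < T -> exists w, [/\ value_radius v w, w <= T,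
  v != None -> w < T & forall x : Qv R v, absv x < T -> absv x <= w].
Proof.
move=> T0; case: v => [p|]; last by exists T; split => // x /ltW.
pose P : R := (val p)%:R.
have P1 : 1 < P by rewrite ltr1n prime_gt1 // (valP p).
have P0 : 0 < P by apply: lt_trans P1.
have lP : 0 < ln P by rewrite ln_gt0.
pose y := ln T / ln P.
(* Ceiling minus one instead of the floor: the power has to stay below [T] even when [T] is itself a
   power of the prime. *)
pose k := Num.ceil y - 1.
have PE (j : int) : P ^ j = expR (j%:~R * ln P).
  by rewrite -powR_intmul ?(ltW P0) // /powR gt_eqF.
have TE : T = expR (y * ln P) by rewrite /y divfK ?gt_eqF // lnK.
have ky : k%:~R < y by rewrite /k -ceil_gt_int ltrBlDr ltrDl.
have yk : y <= (k + 1)%:~R by rewrite /k subrK ceil_ge.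
have kT : P ^ k < T by rewrite PE TE ltr_expR ltr_pM2r.
exists (P ^ k); split; [by exists k|exact: ltW|by []|].
move=> x xT; have [->|x0] := eqVneq x 0; first by rewrite absv0 ltW // exprz_gt0.
have [j xj] := value_radius_absv x0; rewrite xj in xT *.
suff jk : (j < k + 1)%R by rewrite ler_eXz2l // -ltzD1.
rewrite -(ltr_eXz2l P1); apply: lt_le_trans xT _.
by rewrite TE PE ler_expR ler_wpM2r // ltW.
Qed.

Lemma small_Qv v (e : R) : 0 < e -> exists2 h : Qv R v, h != 0 & absv h < e.
Proof.
move=> e0; case: v => [p|]; last first.
  exists (e / 2); first by rewrite gt_eqF // divr_gt0.
  by rewrite /= gtr0_norm ?divr_gt0 //; lra.
have [w [[k wk] we _ _]] := floor_radius (Some p) (divr_gt0 e0 (ltr0Sn R 1)).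
have pp := valP p; have p0 : (val p)%:R != 0 :> rat by rewrite pnatr_eq0 -lt0n prime_gt0.
have aE : absv (ratr ((val p)%:R ^ (- k)) : Qv R (Some p)) = w.
  rewrite absv_ratr /= padic_normXz // padic_norm_prime // eqxx.
  by rewrite exprz_inv opprK.
have w0 : 0 < w by rewrite (@value_radius_gt0 (Some p)) //; exists k.
exists (ratr ((val p)%:R ^ (- k))); first by rewrite -absv_gt0 aE.
by rewrite aE; apply: le_lt_trans we _; lra.
Qed.

Lemma uniformizer_power (p : {p : nat | prime p}) (w : R) : value_radius (Some p) w ->
  exists t : Qv R (Some p), absv t = w.
Proof.
move=> [k ->]; exists (ratr ((val p)%:R ^ (- k))).
rewrite absv_ratr /= padic_normXz ?(valP p) // padic_norm_prime ?(valP p) // eqxx.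
by rewrite exprz_inv opprK.
Qed.

(** An element of absolute value [w] rescales the ball to the ring of integers, whose residue
    classes modulo [p] are represented by 0, ..., p-1. The last clause makes the pieces disjoint, as
    the exact Haar measure requires. *)
Lemma padic_ball_split (p : {p : nat | prime p}) (w : R) : value_radius (Some p) w ->
  exists off : nat -> Qv R (Some p),
    [/\ forall i, absv (off i) <= w,
        forall x, absv x <= w -> exists2 i, (i < val p)%N & absv (x - off i) <= w / (val p)%:R &
        forall i j, (i < val p)%N -> (j < val p)%N ->
          absv (off i - off j) <= w / (val p)%:R -> i = j].
Proof.
move=> hw; have [t tw] := uniformizer_power hw; have w0 := value_radius_gt0 hw.
have t0 : t != 0 by rewrite -absv_gt0 tw.
have pp := valP p; have p0 : 0 < (val p)%:R :> R by rewrite ltr0n prime_gt0.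
exists (fun i => ratr i%:R * t); split.
- move=> i; rewrite absvM tw ler_piMl ?(ltW w0) // absv_ratr /=.
  exact: (padic_norm_int _ pp i).
- move=> x xw; have [q hq] := @Qv_dense R (Some p) (x / t) (val p)%:R^-1 ltac:(by rewrite invr_gt0).
  have xt1 : absv (x / t) <= 1 by rewrite absvM absvV tw ler_pdivrMr // mul1r.
  have q1 : padic_norm R (val p) q <= 1.
    rewrite -[padic_norm _ _ _]/(place_abs R (Some p) q) -absv_ratr.
    have := @absv_ultra R (Some p) (ratr q - x / t) (x / t) isT.
    rewrite subrK absvB => /le_trans -> //; rewrite ge_max xt1 andbT.
    by apply: le_trans (ltW hq) _; rewrite invf_le1 // ler1n prime_gt0.
  have [i ip hi] := padic_residue pp q1; exists i => //.
  have -> : x - ratr i%:R * t = (x / t - ratr i%:R) * t by rewrite mulrBl divfK.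
  rewrite absvM tw mulrC ler_pM2l //.
  have := @absv_ultra R (Some p) (x / t - ratr q) (ratr q - ratr i%:R) isT.
  rewrite addrA subrK => /le_trans -> //; rewrite ge_max (ltW hq) andTb.
  by rewrite -ratr_QvB absv_ratr.
(* A nonzero difference of two residues is prime to [p], so it has norm 1, which is more than
   [1/p]. *)
- have wlg i j : (i <= j)%N -> (j < val p)%N ->
      absv (ratr i%:R * t - ratr j%:R * t) <= w / (val p)%:R -> i = j.
    move=> ij jp; rewrite -mulrBl absvM tw mulrC ler_pM2l // -ratr_QvB absv_ratr /=.
    have -> : (i%:R - j%:R : rat) = (- (j - i)%N%:Z)%:~R.
      by rewrite intrN -pmulrn natrB // opprB.
    have [ji _|ji] := posnP (j - i)%N.
      by apply/eqP; rewrite eqn_leq ij -subn_eq0 ji.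
    rewrite padic_norm_intE ?oppr_eq0 ?eqz_nat -?lt0n // abszN.
    rewrite lognE pp ji /= gtnNdvd // ?expr0 ?invr1.
      by rewrite leNgt invf_lt1 // ltr1n prime_gt1.
    by apply: leq_ltn_trans jp; exact: leq_subr.
  move=> i j ip jp h; have [ij|/ltnW ji] := leqP i j; first exact: wlg.
  by apply/esym; apply: wlg => //; rewrite absvB.
Qed.

(** Only a covering: the two closed halves of a real interval share their midpoint. *)
Lemma ball_split v (w : R) : value_radius v w ->
  exists off : nat -> Qv R v, forall x, absv x <= w ->
    exists2 i, (i < place_base v)%N & absv (x - off i) <= w / (place_base v)%:R.
Proof.
case: v => [p|] hw; first by have [off [_ h _]] := padic_ball_split hw; exists off.
exists (fun i => if i is 0 then w / 2 else - (w / 2)) => x /=.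
rewrite /= ler_norml => /andP[h1 h2].
have [x0|x0] := leP 0 (x : R); [exists 0%N|exists 1%N] => //;
  rewrite ler_norml; apply/andP; split; lra.
Qed.

End Radius.

(** * Counting S-integers of bounded size *)

Section Counting.
Context {R : realType} (S : {fset place}).

(** Multiplying [z] by the product [P] of the finite radii makes it integral at every prime, hence
    an integer. The real bound confines this integer to absolute value at most [P] times the real
    radius, which is the product of all radii. *)
Lemma S_integer_count (hS : None \in S) (w : S -> R) :
  (forall v : S, value_radius (val v) (w v)) ->
  exists s : seq rat, (size s)%:R <= 2 * \prod_(v : S) w v + 1 /\
    forall z, S_integer R S z -> (forall v : S, place_abs R (val v) z <= w v) -> z \in s.
Proof.
move=> hw.
have /choice[k hk] (v : S) : exists k : int,
    if val v is Some p then w v = (val p)%:R ^ k else True.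
  by have := hw v; case: (val v) => [p|] /=; [move=> [k ->]; exists k|exists 0].
pose P0 (v : S) : rat := if val v is Some p then (val p)%:R ^ k v else 1.
have P0gt0 v : 0 < P0 v.
  rewrite /P0; case: (val v) => [p|] //.
  by rewrite exprz_gt0 // ltr0n prime_gt0 // (valP p).
pose P := \prod_v P0 v.
have Pgt0 : 0 < P by apply: prodr_gt0 => v _.
pose vN : S := [` hS]%fset.
have PwE : ratr P * w vN = \prod_v w v.
  rewrite /P (rmorph_prod (@ratr R)) [RHS](bigD1 vN) //= [w vN * _]mulrC.
  rewrite (bigD1 vN) //= {1}/P0 /= rmorph1 mul1r; congr (_ * _).
  apply: eq_bigr => v vvN; have := hk v; rewrite /P0.
  case E : (val v) => [p|]; last first.
    by move: vvN; rewrite -val_eqE /= E eqxx.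
  move=> ->; case: (k v) => n; first by rewrite /exprz rmorphXn /= ratr_nat.
  by rewrite /exprz fmorphV rmorphXn /= ratr_nat.
pose X := \prod_v w v.
have X0 : 0 <= X by apply: prodr_ge0 => v _; rewrite ltW // (value_radius_gt0 (hw v)).
pose M := Num.truncn X.
(* The numerators [j - M] run through all integers of absolute value at most [M]. *)
exists [seq (j%:Z - M%:Z)%:~R / P | j <- iota 0 (2 * M).+1]; split.
  rewrite size_map size_iota -natr1 natrM lerD2r ler_pM2l //.
  by rewrite truncn_le.
move=> z zS zw.
have [m mE] : exists m : int, z * P = m%:~R.
  apply: (padic_integer_int (R := R)) => l pl.
  pose L : place := Some (exist _ l pl : {p : nat | prime p}).
  rewrite padic_normM // /P (big_morph (padic_norm R l) (padic_normM R pl) (padic_norm1 R pl)).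
  have one (v : S) : val v != L -> padic_norm R l (P0 v) = 1.
    rewrite /P0; case: (val v) => [p|]; last by rewrite padic_norm1.
    move=> pL; rewrite padic_normXz // padic_norm_prime ?(valP p) //.
    case: eqP => [pl'|_]; last by rewrite exp1rz.
    by case/eqP: pL; congr Some; apply: val_inj.
  (* Outside [S] the factor [P] is a unit at [l] and [z] is integral there; inside [S] the norm of
     [P] at [l] is the inverse of the radius that bounds [z]. *)
  have [LS|LS] := boolP (L \in S); last first.
    rewrite big1 ?mulr1; first exact: (zS L).
    by move=> v _; apply: one; apply: contraNneq LS => <-; exact: valP.
  pose vL : S := [` LS]%fset.
  rewrite (bigD1 vL) //= big1 ?mulr1; last first.
    by move=> v vL'; apply: one; rewrite -val_eqE in vL'.
  have := hk vL; have := zw vL; rewrite /P0 /= => hz wE.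
  rewrite padic_normXz // padic_norm_prime // eqxx exprz_inv -invr_expz -wE.
  by rewrite ler_pdivrMr ?mul1r // (value_radius_gt0 (hw vL)).
have mM : (`|m| <= M)%N.
  rewrite /M truncn_ge_nat //.
  have -> : `|m|%N%:R = `|m%:~R| :> R by rewrite pmulrn -intr_norm -abszE.
  rewrite -[m%:~R]ratr_int -mE rmorphM normrM /= (gtr0_norm (_ : 0 < ratr P)) ?ltr0q //.
  by rewrite /X -PwE mulrC ler_pM2l ?ltr0q //; exact: (zw vN).
have /andP[m1 m2] : - M%:Z <= m <= M%:Z by rewrite -ler_norml -abszE lez_nat.
have mME : (absz (m + M%:Z))%:Z = m + M%:Z by rewrite gez0_abs // -lerBlDr sub0r.
apply/mapP; exists (absz (m + M%:Z)); last by rewrite mME addrK -mE mulfK // gt_eqF.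
by rewrite mem_iota /= add0n ltnS -lez_nat mME mul2n -addnn PoszD lerD2r.
Qed.

End Counting.

(** * Measures of balls *)

Definition cell {R : realType} {v : place} (c : Qv R v) (w : R) : set (Qv R v) :=
  [set x | absv (x - c) <= w].

(* The measure of a closed ball divided by its radius. *)
Definition ball_factor (R : realType) (v : place) : R := if v is None then 2 else 1.

Section BallMeasure.
Context {R : realType}.

Lemma sume_ord_const n (x : \bar R) : (\sum_(i < n) x = n%:R%:E * x)%E.
Proof.
elim: n => [|n IH]; first by rewrite big_ord0 mul0e.
by rewrite big_ord_recr /= IH -natr1 EFinD ge0_muleDl ?lee_fin // mul1e.
Qed.

Lemma measurable_oball v (c : Qv R v) (r : R) :
  measurable (oball c r : set (Qv_borel R v)).
Proof.
apply: sub_sigma_algebra => x xc; exists (r - absv (x - c)); first by rewrite subr_gt0.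
by move=> y /= yx; rewrite /oball /=; apply: le_lt_trans (absv_split x y c) _;
  move: yx; rewrite /oball /=; lra.
Qed.

Lemma measurable_cell v (c : Qv R v) (w : R) : measurable (cell c w : set (Qv_borel R v)).
Proof.
rewrite -(setCK (cell c w)); apply: measurableC; apply: sub_sigma_algebra => x.
move=> /negP; rewrite -ltNge => xc; exists (absv (x - c) - w); first by rewrite subr_gt0.
move=> y /= yx; apply/negP; rewrite -ltNge; have := absv_split y x c.
by rewrite (absvB x y); move: yx; rewrite /oball /=; lra.
Qed.

Lemma padic_cell_step (p : {p : nat | prime p})
    (mu : {measure set (Qv_borel R (Some p)) -> \bar R}) (hmu : is_mu_v mu) (w : R) :
  value_radius (Some p) w ->
  (mu (cell 0 w) = (val p)%:R%:E * mu (cell 0 (w / (val p)%:R)))%E.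
Proof.
move=> hw; have [off [offw cov inj]] := padic_ball_split hw.
have w0 := value_radius_gt0 hw; have p1 := prime_gt1 (valP p).
have wp : w / (val p)%:R <= w.
  by rewrite ler_pdivrMr ?ltr0n 1?ltnW // ler_peMr ?(ltW w0) // ler1n ltnW.
have -> : cell 0 w = \bigcup_(i in `I_(val p)) cell (off i) (w / (val p)%:R).
  apply/seteqP; split=> x; rewrite /cell /=.
    by rewrite subr0 => /cov[i ip hi]; exists i.
  move=> [i ip /= hi]; rewrite subr0.
  have := @absv_ultra R (Some p) (x - off i) (off i) isT; rewrite subrK => /le_trans -> //.
  by rewrite ge_max (le_trans hi wp) offw.
rewrite measure_fin_bigcup //; last by move=> i _; exact: measurable_cell.
  rewrite -fsbig_ord; transitivity (\sum_(i < val p) mu (cell 0 (w / (val p)%:R)))%E.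
    apply: eq_bigr => i _; rewrite -(hmu.1 _ (off i) (measurable_cell 0 _)).
    congr (mu _); apply/seteqP; split=> [x xi|_ [x xi <-]].
      by exists (x - off i); rewrite ?subrK // /cell /= subr0.
    by move: xi; rewrite /cell /= subr0 addrK.
  exact: sume_ord_const.
move=> i j ip jp [x [xi xj]]; apply: inj => //.
have := @absv_ultra R (Some p) (off i - x) (x - off j) isT.
rewrite addrA subrK => /le_trans -> //; rewrite ge_max; apply/andP; split=> //.
by rewrite absvB.
Qed.

(** The normalisation gives the unit ball; [padic_cell_step] then reaches every power of [p] upwards
    and downwards, and invariance moves the centre. *)
Lemma padic_cell_measure (p : {p : nat | prime p})
    (mu : {measure set (Qv_borel R (Some p)) -> \bar R}) (hmu : is_mu_v mu)
    (c : Qv R (Some p)) (w : R) :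
  value_radius (Some p) w -> mu (cell c w) = w%:E.
Proof.
have P0 : (val p)%:R != 0 :> R by rewrite pnatr_eq0 -lt0n prime_gt0 // (valP p).
have vX (n : nat) : value_radius (Some p) ((val p)%:R ^+ n : R) by exists n.
have vV (n : nat) : value_radius (Some p) ((val p)%:R ^- n : R).
  by exists (- n%:Z); rewrite exprnN.
have c1 : mu (cell 0 1) = 1%E.
  by rewrite -hmu.2; congr (mu _); apply/seteqP; split=> x; rewrite /cell /= subr0.
have pos (n : nat) : mu (cell 0 ((val p)%:R ^+ n)) = ((val p)%:R ^+ n)%:E.
  elim: n => [|n IH]; first by rewrite expr0 c1.
  by rewrite (padic_cell_step hmu (vX _)) exprS mulrAC divff // mul1r IH EFinM.
have neg (n : nat) : mu (cell 0 ((val p)%:R ^- n)) = ((val p)%:R ^- n)%:E.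
  elim: n => [|n IH]; first by rewrite expr0 invr1 c1.
  move: IH; rewrite (padic_cell_step hmu (vV _)) -invfM -exprSr.
  (* Cancelling [p] is legitimate only for a finite measure; an infinite smaller ball would
     contradict the finite measure of the larger one. *)
  case: (mu _) => [r|/eqP|/eqP].
  - rewrite -EFinM => -[h]; congr EFin; apply: (mulfI P0); rewrite h.
    by rewrite exprS invfM mulrA divff // mul1r.
  - by rewrite gt0_muley // lte_fin lt_def P0 ler0n.
  - by rewrite gt0_muleNy // lte_fin lt_def P0 ler0n.
move=> [k wk]; have -> : mu (cell c w) = mu (cell 0 w).
  rewrite -(hmu.1 _ c (measurable_cell 0 w)); congr (mu _).
  apply/seteqP; split=> [x xi|_ [x xi <-]].
    by exists (x - c); rewrite ?subrK // /cell /= subr0.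
  by move: xi; rewrite /cell /= subr0 addrK.
by rewrite wk; case: k {wk} => n; rewrite /exprz.
Qed.

Lemma cell_measure v (mu : {measure set (Qv_borel R v) -> \bar R}) (hmu : is_mu_v mu)
    (c : Qv R v) (w : R) :
  value_radius v w -> mu (cell c w) = (ball_factor R v * w)%:E.
Proof.
case: v mu hmu c => [p|] mu hmu c hw; first by rewrite (padic_cell_measure hmu) // mul1r.
rewrite hmu; last exact: measurable_cell.
have -> : cell c w = `[(c : R) - w, (c : R) + w]%classic.
  by apply/seteqP; split=> x; rewrite /cell /= in_itv /= ler_distl.
have w0 : 0 < w := hw.
rewrite lebesgue_measure_itv /= lte_fin ifT; last by lra.
by rewrite -EFinB; congr EFin; rewrite /ball_factor; lra.
Qed.

(** At a finite place the open ball is a closed one; over the reals the endpoints have measure 0. *)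
Lemma oball_cell v (r : R) : 0 < r ->
  exists w, [/\ value_radius v w, w <= r, forall c : Qv R v, oball c r `<=` cell c w &
    forall (mu : {measure set (Qv_borel R v) -> \bar R}) (c : Qv R v), is_mu_v mu ->
      mu (oball c r) = (ball_factor R v * w)%:E].
Proof.
move=> r0; case: v => [p|]; last first.
  exists r; split => // [c x /ltW//|mu c hmu].
  rewrite hmu; last exact: measurable_oball.
  have -> : oball (c : Qv R None) r = `](c : R) - r, (c : R) + r[%classic.
    by apply/seteqP; split=> x; rewrite /oball /= in_itv /= ltr_distl.
  rewrite lebesgue_measure_itv /= lte_fin ifT; last by lra.
  by rewrite -EFinB; congr EFin; rewrite /ball_factor; lra.
have [w [hw wr wltr hx]] := floor_radius (Some p) r0.
exists w; split => // [c x|mu c hmu]; first exact: hx.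
rewrite mul1r -(padic_cell_measure hmu c hw); congr (mu _).
apply/seteqP; split=> x; first exact: hx.
by move=> /le_lt_trans; apply; exact: wltr.
Qed.

End BallMeasure.

(** * Boxes *)

(** Covers are given by lists because the candidates for [z] and for [q] come as lists; repetitions
    only enlarge the sum. *)
Lemma measure_le_sum (dsp : measure_display) (R : realType) (T : measurableType dsp)
    (mu : {measure set T -> \bar R}) (I : eqType) (s : seq I) (F : I -> set T) (A : set T) :
  measurable A -> (forall i, measurable (F i)) ->
  (forall x, A x -> exists2 i, i \in s & F i x) ->
  (mu A <= \sum_(i <- s) mu (F i))%E.
Proof.
move=> mA mF; elim: s A mA => [|i s IH] A mA cov.
  suff -> : A = set0 by rewrite measure0 big_nil.
  by apply/seteqP; split=> x // /cov[].
rewrite big_cons; apply: (@le_trans _ _ (mu (F i `|` (A `\` F i)))).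
  apply: le_measure; rewrite ?inE //; first by apply: measurableU => //; exact: measurableD.
  by move=> x Ax; have [Fx|nFx] := pselect (F i x); [left|right].
apply: le_trans (measureU2 _ _ _) _ => //; first exact: measurableD.
apply: leeD2l; apply: IH; first exact: measurableD.
move=> x [/cov[j]]; rewrite inE => /orP[/eqP-> //|js Fj _]; by exists j.
Qed.

Section Boxes.
Context {R : realType} {S : {fset place}} {d : S -> nat}.
Context (mu_ : forall v : S, {measure set (Qv_borel R (val v)) -> \bar R}).
Context (hmu_ : forall v, is_mu_v (mu_ v)).
Context (mu : {measure set (QSpace_borel R d) -> \bar R}).
Context (hmu : is_product_measure mu_ mu).

Definition box (c : QSpace R d) (w : forall v : S, 'I_(d v) -> R) : set (QSpace_borel R d) :=
  [set x : QSpace R d | forall v i, absv (x v 0 i - c v 0 i) <= w v i].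

Definition vol (w : forall v : S, 'I_(d v) -> R) : R :=
  \prod_v \prod_i (ball_factor R (val v) * w v i).

Lemma absv_le_normv v m n (A : 'M[Qv R v]_(m, n)) i j : absv (A i j) <= normv A.
Proof.
case: v A => [p|] A; rewrite /normv.
  apply: (@le_trans _ _ (\big[Num.max/0]_l absv (A i l))).
    by rewrite (bigD1 j) //= le_max lexx.
  by rewrite [leRHS](bigD1 i) //= le_max lexx.
rewrite -[leLHS]ger0_norm ?absv_ge0 // -sqrtr_sqr ler_wsqrtr //.
rewrite (bigD1 i) //= (bigD1 j) //= -addrA lerDl addr_ge0 // sumr_ge0 // => *.
by apply: sumr_ge0 => *; rewrite exprn_ge0.
Qed.

Lemma measurable_QSpace_open (A : set (QSpace R d)) :
  QSpace_open A -> measurable (A : set (QSpace_borel R d)).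
Proof. by move=> oA; apply: sub_sigma_algebra. Qed.

Lemma measurable_box c w : measurable (box c w).
Proof.
rewrite -(setCK (box c w)); apply: measurableC; apply: measurable_QSpace_open => x.
move=> /existsNP[v /existsNP[i /negP]]; rewrite -ltNge => hx.
exists (absv (x v 0 i - c v 0 i) - w v i); first by rewrite subr_gt0.
move=> y /(_ v) yx /(_ v i); apply/negP; rewrite -ltNge.
have := le_lt_trans (absv_le_normv _ 0 i) yx; rewrite !mxE.
have := absv_split (y v 0 i) (x v 0 i) (c v 0 i); rewrite (absvB (x v 0 i) (y v 0 i)).
lra.
Qed.

Lemma box_measure c w : (forall v i, value_radius (val v) (w v i)) ->
  mu (box c w) = (vol w)%:E.
Proof.
move=> hw; have := hmu (fun v i => measurable_cell (c v 0 i) (w v i)).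
rewrite /box /cell /= => ->; rewrite /vol -prodEFin; apply: eq_bigr => v _.
rewrite -prodEFin; apply: eq_bigr => i _; exact: (cell_measure (hmu_ v)).
Qed.

Lemma ball_factor_gt0 v : 0 < ball_factor R v.
Proof. by case: v => [p|]; rewrite /ball_factor ?ltr01 ?ltr0Sn. Qed.

Lemma vol_gt0 w : (forall v i, 0 < w v i) -> 0 < vol w.
Proof.
by move=> w0; do 2!(apply: prodr_gt0 => ? _); rewrite mulr_gt0 ?ball_factor_gt0.
Qed.

Lemma volM w g : vol (fun v i => w v i * g v i) = vol w * \prod_v \prod_i g v i.
Proof.
rewrite /vol -big_split /=; apply: eq_bigr => v _; rewrite -big_split /=.
by apply: eq_bigr => i _; rewrite mulrA.
Qed.

(** Coordinates at different places have different index types, so one coordinate of the whole space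
    is named by a dependent pair. *)
Definition at_coord (p : {v : S & 'I_(d v)}) (v : S) (i : 'I_(d v)) : bool :=
  existT (fun v : S => 'I_(d v)) v i == p.

Lemma at_coordE v (i j : 'I_(d v)) : at_coord (existT _ v i) j = (j == i).
Proof. by rewrite /at_coord (@eq_Tagged _ _ (existT _ v j)). Qed.

Lemma at_coord_neq u v (i : 'I_(d v)) (j : 'I_(d u)) : u != v ->
  at_coord (existT _ v i) j = false.
Proof. by move=> uv; apply/eqP => -[uv']; rewrite uv' eqxx in uv. Qed.

Lemma prod_at (p : {v : S & 'I_(d v)}) (z : R) :
  \prod_v \prod_(i < d v) (if at_coord p i then z else 1) = z.
Proof.
case: p => v0 i0; rewrite (bigD1 v0) //= (bigD1 i0) //= at_coordE eqxx.
rewrite big1 ?mulr1 => [|i ip]; last by rewrite at_coordE (negbTE ip).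
by rewrite big1 ?mulr1 // => v vv0; apply: big1 => i _; rewrite at_coord_neq.
Qed.

(** The pieces cut along the coordinate [p] cover the box and their volumes add up to its volume, so
    a bound relative to volume passes from the pieces to the box. *)
Lemma box_split (E : set (QSpace_borel R d)) (mE : measurable E) (k : R)
    (w : forall v : S, 'I_(d v) -> R) (hw : forall v i, value_radius (val v) (w v i))
    (p : {v : S & 'I_(d v)}) :
  let w' v i := w v i * (if at_coord p i
                         then (place_base (val (tag p)))%:R^-1 else 1) in
  (forall c, (mu (E `&` box c w') <= (k * vol w')%:E)%E) ->
  forall c, (mu (E `&` box c w) <= (k * vol w)%:E)%E.
Proof.
move=> w' hw' c; set b := place_base (val (tag p)).
(* Stated for every radius so that [off] is a total function; 0 is a dummy outside the value
   group. *)
have offE (v : place) (u : R) : {off : nat -> Qv R v | value_radius v u ->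
    forall x, absv x <= u ->
    exists2 i, (i < place_base v)%N & absv (x - off i) <= u / (place_base v)%:R}.
  apply: cid; have [hu|hu] := pselect (value_radius v u).
    by have [off h] := ball_split hu; exists off.
  by exists (fun=> 0).
pose off v i j := if at_coord p i
  then projT1 (offE (val v) (w v i)) j else 0.
pose cj (j : nat) : QSpace R d := fun v => \row_i (c v 0 i + off v i j).
apply: (@le_trans _ _ (\sum_(j <- iota 0 b) mu (E `&` box (cj j) w'))%E).
  apply: measure_le_sum.
  - by apply: measurableI => //; exact: measurable_box.
  - by move=> j; apply: measurableI => //; exact: measurable_box.
  move=> x [Ex bx].
  have := projT2 (offE (val (tag p)) (w _ (tagged p))) (hw _ _) _ (bx _ (tagged p)).
  move=> [j jb hj]; exists j; first by rewrite mem_iota.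
  split=> // v i; rewrite /cj mxE /w' /off /at_coord.
  case: eqP => [pE|_]; last by rewrite addr0 mulr1.
  by move: hj; rewrite -pE /= opprD addrA.
apply: (@le_trans _ _ (\sum_(j <- iota 0 b) (k * vol w')%:E)%E).
  by apply: lee_sum => j _; exact: hw'.
rewrite sumEFin lee_fin big_const_seq count_predT size_iota iter_addr_0 -mulr_natr.
rewrite /w' volM prod_at -/b -mulrA divfK //.
by rewrite gt_eqF // place_base_gt0.
Qed.

(* Local-to-global bound over a grid; it takes the place of Fubini's theorem. *)
Lemma box_refine (E : set (QSpace_borel R d)) (mE : measurable E) (z : R)
    (w : forall v : S, 'I_(d v) -> R) (hw : forall v i, value_radius (val v) (w v i))
    (k : forall v : S, 'I_(d v) -> nat) :
  let w' v i := w v i / (place_base (val v))%:R ^+ k v i in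
  (forall c, (mu (E `&` box c w') <= (z * vol w')%:E)%E) ->
  forall c, (mu (E `&` box c w) <= (z * vol w)%:E)%E.
Proof.
pose wk k v i := w v i / (place_base (val v))%:R ^+ k v i.
move=> w'; rewrite -[w']/(wk k) {w'}.
(* Induction on the total number of cuts: [k'] below has one cut fewer, in one coordinate, and
   [box_split] carries the bound over to it. *)
have [m] := ubnP (\sum_v \sum_i k v i)%N; elim: m k => // m IH k km hk.
have [k0|] := pselect (forall v i, k v i = 0%N).
  rewrite (_ : wk k = w) // in hk; apply: functional_extensionality_dep => v.
  by apply/funext => i; rewrite /wk k0 expr0 divr1.
move=> /existsNP[v0 /existsNP[i0 /eqP k0]].
pose p : {v : S & 'I_(d v)} := Tagged (fun v : S => 'I_(d v)) i0.
pose k' v i := (k v i - (at_coord p i))%N.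
apply: (IH k').
  rewrite -ltnS; apply: leq_trans km; rewrite ltnS.
  rewrite (bigD1 v0) //= (bigD1 i0) //= [ltnRHS](bigD1 v0) //= [X in (_ < X + _)%N](bigD1 i0) //=.
  rewrite -addnA -[ltnRHS]addnA -addSn; apply: leq_add.
    by rewrite /k' /p at_coordE eqxx subn1 prednK // lt0n.
  by apply: leq_add; [|apply: leq_sum => v _]; apply: leq_sum => i _; exact: leq_subr.
have w2E : (fun v i => wk k' v i * (if at_coord p i
    then (place_base (val (tag p)))%:R^-1 else 1)) = wk k; last first.
  by apply: (@box_split E mE z (wk k') _ p); [move=> v i; exact: value_radius_divX|rewrite w2E].
apply: functional_extensionality_dep => v; apply/funext => i; rewrite /wk /k' /at_coord.
case: eqP => [pE|_]; last by rewrite subn0 mulr1.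
have {}k0 : k v i != 0%N by move: k0; rewrite -[k v0 i0]/(k (tag p) (tagged p)) -pE.
rewrite -pE /= subn1 -{2}(prednK (_ : 0 < k v i)%N) ?lt0n //.
by rewrite exprSr invfM mulrA.
Qed.

End Boxes.

(** * Difference quotients and partial derivatives *)

Section DifferenceQuotients.
Context {R : realType} {v : place} {d : nat}.
Local Notation K := (Qv R v).
Implicit Types (i j : 'I_d) (x y : 'rV[K]_d) (p : 'I_d -> nat -> K).

Definition upd x i (t : K) : 'rV[K]_d := \row_k (if k == i then t else x 0 k).

Lemma upd_id x i : upd x i (x 0 i) = x.
Proof. by apply/rowP => k; rewrite mxE; case: eqP => // ->. Qed.

Lemma upd_eq x i t : upd x i t 0 i = t.
Proof. by rewrite mxE eqxx. Qed.

Lemma upd_neq x i j t : j != i -> upd x i t 0 j = x 0 j.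
Proof. by move=> /negbTE ji; rewrite mxE ji. Qed.

Lemma upd_upd x i s t : upd (upd x i s) i t = upd x i t.
Proof. by apply/rowP => k; rewrite !mxE; case: eqP. Qed.

Lemma updC x i j s t : i != j -> upd (upd x i s) j t = upd (upd x j t) i s.
Proof.
move=> ij; apply/rowP => k; rewrite !mxE.
by have [->|//] := eqVneq k j; rewrite eq_sym (negbTE ij).
Qed.

Definition set_points p i (t : K) : 'I_d -> nat -> K := fun k => if k == i then fun=> t else p k.

(** Among the points of coordinate [j] only the first one matters to [F], as is the case before a
    quotient is taken in that coordinate. A quotient of order 0 in [j] then leaves [F] unchanged. *)
Definition reads_head (F : ('I_d -> nat -> K) -> K) j :=
  forall p, F (set_points p j (p j 0%N)) = F p.

Lemma set_pointsC p i j s t : i != j ->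
  set_points (set_points p i s) j t = set_points (set_points p j t) i s.
Proof.
move=> ij; apply/funext => k; rewrite /set_points.
by have [->|//] := eqVneq k j; rewrite eq_sym (negbTE ij).
Qed.

Definition dq_foldr (beta : 'I_d -> nat) (l : seq 'I_d) (F : ('I_d -> nat -> K) -> K) :=
  foldr (fun j F => dq_coord j (beta j) F) F l.

Lemma reads_head_dq F i j k : i != j -> reads_head F j -> reads_head (dq_coord i k F) j.
Proof.
move=> ij hF p; rewrite /dq_coord.
have -> : set_points p j (p j 0%N) i = p i by rewrite /set_points (negbTE ij).
congr (dq _ _ _); apply/funext => t.
rewrite -/(set_points (set_points p j (p j 0%N)) i t) -/(set_points p i t).
rewrite set_pointsC 1?eq_sym // -[in RHS]hF; congr (F (set_points _ _ _)).
by rewrite /set_points eq_sym (negbTE ij).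
Qed.

Lemma reads_head_foldr beta l F j : j \notin l -> reads_head F j ->
  reads_head (dq_foldr beta l F) j.
Proof.
elim: l => //= i l IH; rewrite inE negb_or => /andP[ji jl] hF.
by apply: reads_head_dq; rewrite 1?eq_sym //; exact: IH.
Qed.

Lemma dq_foldr_filter beta l F : uniq l -> (forall j, reads_head F j) ->
  dq_foldr beta l F = dq_foldr beta [seq j <- l | beta j != 0%N] F.
Proof.
move=> + hF; elim: l => //= j l IH /andP[jl ul].
have [bj|_] := eqVneq (beta j) 0%N; last by rewrite /= -IH.
rewrite -IH // bj; apply/funext => p; exact: (reads_head_foldr beta jl (hF j) p).
Qed.

(** Reduces a multi-index of order 2 to the one or two coordinates in which it is nonzero, so that
    the quotient can be computed. *)
Lemma dq_multi_filter beta (f : 'rV[K]_d -> K) :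
  dq_multi beta f =
  foldr (fun j F => dq_coord j (beta j) F) (fun p => f (\row_j p j 0%N))
    [seq j <- enum 'I_d | beta j != 0%N].
Proof.
apply: dq_foldr_filter; first exact: enum_uniq.
by move=> j p; congr f; apply/rowP => k; rewrite !mxE /set_points; case: eqP => // ->.
Qed.

Context (c : 'rV[K]_d) (r : 'I_d -> R) (f : 'rV[K]_d -> K).
Local Notation U := (obox c r).
Local Notation Ui := (fun i => oball (c 0 i) (r i)).
Hypothesis hdq : forall beta : 'I_d -> nat, (\sum_i beta i)%N = 2%N ->
  exists2 G, is_dq_extension Ui beta f G & forall p, dq_dom Ui beta p -> absv (G p) <= 2^-1.

Lemma dq_bound beta p : (\sum_i beta i)%N = 2%N -> dq_dom Ui beta p ->
  dq_distinct beta p -> absv (dq_multi beta f p) <= 2^-1.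
Proof. by move=> /hdq[G [hG _] bG] pU pD; rewrite -hG //; exact: bG. Qed.

Lemma obox_upd x i t : U x -> Ui i t -> U (upd x i t).
Proof. by move=> Ux Ut k; rewrite mxE; case: eqP => // ->. Qed.

(** The multi-index is 2 in the single coordinate [i]. Both inner quotients share the point [s2];
    for [s2] equal to [x 0 i] the bound compares two slopes at [x]. *)
Lemma pure_dq_bound x i (s0 s1 s2 : K) : U x -> Ui i s0 -> Ui i s1 -> Ui i s2 ->
  s0 != s1 -> s0 != s2 -> s1 != s2 ->
  absv (((f (upd x i s0) - f (upd x i s2)) / (s0 - s2) -
         (f (upd x i s1) - f (upd x i s2)) / (s1 - s2)) / (s0 - s1)) <= 2^-1.
Proof.
move=> Ux U0 U1 U2 s01 s02 s12.
pose beta j := if j == i then 2%N else 0%N.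
pose p (j : 'I_d) (k : nat) : K :=
  if j == i then (if k is k'.+1 then if k' is 0 then s1 else s2 else s0) else x 0 j.
have sb : (\sum_j beta j)%N = 2%N.
  by rewrite /beta -big_mkcond big_pred1_eq.
have pU : dq_dom Ui beta p.
  move=> j k; rewrite /beta /p; case: eqP => [->|_ _]; last exact: Ux.
  by case: k => [|[|]].
have pD : dq_distinct beta p.
  move=> j k l; rewrite /beta /p; case: eqP => _; last by case: l => //; case: k.
  by case: k l => [|[|[|k]]] [|[|[|l]]].
have := dq_bound sb pU pD; rewrite dq_multi_filter.
rewrite (eq_filter (a2 := pred1 i)); last by move=> j; rewrite /beta /=; case: (j == i).
rewrite filter_pred1_uniq ?enum_uniq ?mem_enum //= /beta eqxx.
have E t : f (\row_j (if j == i then fun=> t else p j) 0%N) = f (upd x i t).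
  by congr f; apply/rowP => j; rewrite !mxE; case: eqP => // /eqP ji; rewrite /p (negbTE ji).
by rewrite /dq_coord /= /dq /= !E /p eqxx /=.
Qed.

(** Denominators are multiplied out, so that coinciding points are allowed. *)
Lemma mixed_dq_bound x i j (a a' b b' : K) : i != j -> U x ->
  Ui i a -> Ui i a' -> Ui j b -> Ui j b' ->
  absv (f (upd (upd x i a) j b) - f (upd (upd x i a) j b') -
        (f (upd (upd x i a') j b) - f (upd (upd x i a') j b')))
    <= 2^-1 * absv (a - a') * absv (b - b').
Proof.
(* The nesting of the two quotients follows the order of [enum]. One order is treated here; the
   other follows by exchanging the roles, as the mixed difference is symmetric. *)
have main i0 j0 (a0 a1 b0 b1 : K) : i0 != j0 -> U x ->
    Ui i0 a0 -> Ui i0 a1 -> Ui j0 b0 -> Ui j0 b1 -> a0 != a1 -> b0 != b1 ->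
    [seq k <- enum 'I_d | (k == i0) || (k == j0)] = [:: i0; j0] ->
    absv (f (upd (upd x i0 a0) j0 b0) - f (upd (upd x i0 a0) j0 b1) -
        (f (upd (upd x i0 a1) j0 b0) - f (upd (upd x i0 a1) j0 b1)))
    <= 2^-1 * absv (a0 - a1) * absv (b0 - b1).
  move=> ij Ux Ua0 Ua1 Ub0 Ub1 a01 b01 enumE.
  pose beta k := ((k == i0) || (k == j0) : nat).
  pose p (k : 'I_d) (m : nat) : K :=
    if k == i0 then (if m is 0 then a0 else a1)
    else if k == j0 then (if m is 0 then b0 else b1) else x 0 k.
  have sb : (\sum_k beta k)%N = 2%N.
    rewrite -[2%N]/(size [:: i0; j0]) -enumE size_filter -sum1_count big_enum_cond /=.
    by rewrite [RHS]big_mkcond; apply: eq_bigr => k _; rewrite /beta; case: (_ || _).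
  have pU : dq_dom Ui beta p.
    move=> k m; rewrite /p; case: eqP => [-> _|_]; first by case: m.
    by case: eqP => [-> _|_ _]; [case: m|exact: Ux].
  have pD : dq_distinct beta p.
    move=> k m l; rewrite /beta /p; have [_|_] /= := eqVneq k i0; first by case: m l => [|m] [|[|l]].
    by have [_|_] /= := eqVneq k j0; case: m l => [|m] [|[|l]].
  have := dq_bound sb pU pD; rewrite dq_multi_filter.
  rewrite (eq_filter (a2 := fun k => (k == i0) || (k == j0))); last first.
    by move=> k; rewrite /beta; case: (_ || _).
  rewrite enumE /= /beta !eqxx orbT /=.
  have E s t : f (\row_k (if k == j0 then fun=> t else if k == i0 then fun=> s else p k) 0%N)
      = f (upd (upd x i0 s) j0 t).
    congr f; apply/rowP => k; rewrite !mxE; case: eqP => // /eqP kj; case: eqP => // /eqP ki.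
    by rewrite /p (negbTE kj) (negbTE ki).
  rewrite /dq_coord /= /dq /= !E [j0 == i0]eq_sym (negbTE ij) /p !eqxx [j0 == i0]eq_sym (negbTE ij) /=.
  have aa : 0 < absv (a0 - a1) by rewrite absv_gt0 subr_eq0.
  have bb : 0 < absv (b0 - b1) by rewrite absv_gt0 subr_eq0.
  by rewrite -mulrBl 2!absvM 2!absvV !ler_pdivrMr.
move=> ij Ux Ua Ua' Ub Ub'.
have [->|aa] := eqVneq a a'; first by rewrite !subrr absv0 mulr0 mul0r.
have [->|bb] := eqVneq b b'; first by rewrite !subrr absv0 mulr0.
pose l := [seq k <- enum 'I_d | (k == i) || (k == j)].
have : perm_eq l [:: i; j].
  apply: uniq_perm; [exact: filter_uniq (enum_uniq _)|by rewrite /= inE ij|].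
  by move=> k; rewrite mem_filter mem_enum !inE andbT.
move=> pl; have [lij|lji] : l = [:: i; j] \/ l = [:: j; i].
- move: (perm_size pl) (perm_mem pl) (perm_uniq pl); case: l {pl} => [|k [|k' []]] //= _ lE.
  rewrite !inE ij /= andbT => kk'; have := lE k; have := lE k'; rewrite !inE !eqxx orbT /=.
  move=> /esym/orP[] /eqP k'E /esym/orP[] /eqP kE; rewrite k'E kE ?eqxx // in kk' *.
  - by right.
  - by left.
- exact: main.
have := main j i b b' a a'; rewrite eq_sym ij => /(_ isT Ux Ub Ub' Ua Ua' bb aa).
rewrite (eq_filter (a2 := fun k => (k == i) || (k == j))) => [/(_ lji)|k]; last by rewrite orbC.
rewrite ![upd (upd x j _) i _]updC 1?eq_sym // mulrAC; congr (absv _ <= _).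
by rewrite !opprB; ring.
Qed.


Definition slope x i (t : K) := (f (upd x i t) - f x) / (t - x 0 i).

Lemma slope_bound x i (s t : K) : U x -> Ui i s -> Ui i t -> s != x 0 i -> t != x 0 i ->
  absv (slope x i s - slope x i t) <= 2^-1 * absv (s - t).
Proof.
move=> Ux Us Ut sx tx.
have [->|st] := eqVneq s t; first by rewrite !subrr absv0 mulr0.
have := pure_dq_bound Ux Us Ut (Ux i) st sx tx; rewrite upd_id absvM absvV.
by rewrite ler_pdivrMr // absv_gt0 subr_eq0.
Qed.

Lemma oball_near x i : U x -> exists2 e : R, 0 < e &
  forall h : K, absv h < e -> Ui i (x 0 i + h).
Proof.
move=> Ux; exists (r i - absv (x 0 i - c 0 i)); first by rewrite subr_gt0; exact: Ux.
move=> h hh; rewrite /oball /= addrAC; apply: le_lt_trans (absv_triangle _ _) _; lra.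
Qed.

Lemma is_partial_uniq (g : 'rV[K]_d -> K) i x (l l' : K) :
  is_partial g i x l -> is_partial g i x l' -> l = l'.
Proof.
move=> hl hl'; apply/eqP; rewrite -subr_eq0 -absv_eq0 eq_le absv_ge0 andbT.
apply/ler_addgt0Pr => e e0; rewrite add0r.
have e2 : 0 < e / 2 by rewrite divr_gt0.
have [r1 r10 h1] := hl _ e2; have [r2 r20 h2] := hl' _ e2.
have [h h0 hr] : exists2 h : K, h != 0 & absv h < Num.min r1 r2.
  by apply: small_Qv; rewrite lt_min r10.
move: hr; rewrite lt_min => /andP[hr1 hr2].
have := h1 h h0 hr1; have := h2 h h0 hr2; set q := _ / h => k2 k1.
have := absv_split q l l'; rewrite (absvB l q); lra.
Qed.

Lemma shift_upd x i (h : K) : x + h *: delta_mx 0 i = upd x i (x 0 i + h).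
Proof.
apply/rowP => k; rewrite !mxE eqxx /=; case: eqP => [->|_]; first by rewrite mulr1.
by rewrite mulr0 addr0.
Qed.

(** By [slope_bound] the slopes along increments tending to 0 form a Cauchy sequence. Its limit is
    the partial derivative, and the bound survives the passage to the limit. *)
Lemma slope_partial x i (t : K) : U x -> Ui i t -> t != x 0 i ->
  absv (slope x i t - partial f i x) <= 2^-1 * absv (t - x 0 i).
Proof.
move=> Ux Ut tx; have [e e0 eU] := oball_near i Ux.
have hseq (k : nat) : {h : K | h != 0 /\ absv h < Num.min e (k.+1%:R^-1)}.
  apply: cid; have [|h h0 hk] := @small_Qv R v (Num.min e k.+1%:R^-1).
    by rewrite lt_min e0 invr_gt0 ltr0n.
  by exists h.
pose h k := projT1 (hseq k).
have h0 k : h k != 0 by have [] := projT2 (hseq k).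
have he k : absv (h k) < e by have [_] := projT2 (hseq k); rewrite lt_min => /andP[].
have hk k : absv (h k) < k.+1%:R^-1.
  by have [_] := projT2 (hseq k); rewrite lt_min => /andP[].
have small (z : R) : 0 < z -> exists N, forall n, (N <= n)%N -> absv (h n) < z.
  move=> z0; have [N _ hN] := near_infty_natSinv_lt (PosNum z0).
  by exists N => n /hN; apply: lt_trans.
have hx k : x 0 i + h k != x 0 i by rewrite -subr_eq0 addrAC subrr add0r.
have [l hl] : exists l, forall z : R, 0 < z -> exists N, forall n, (N <= n)%N ->
    absv (slope x i (x 0 i + h n) - l) < z.
  apply: Qv_complete => z z0; have [N hN] := small z z0.
  exists N => m n mN nN; apply: le_lt_trans (slope_bound Ux _ _ _ _) _ => //; try exact: eU.
  have := absv_subD (h m) (h n).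
  have -> : x 0 i + h m - (x 0 i + h n) = h m - h n by ring.
  have := hN _ mN; have := hN _ nN; lra.
have lim s : Ui i s -> s != x 0 i -> absv (slope x i s - l) <= 2^-1 * absv (s - x 0 i).
  move=> Us sx; apply/ler_addgt0Pr => z z0.
  have z2 : 0 < z / 2 by rewrite divr_gt0.
  have [N1 h1] := small _ z2; have [N2 h2] := hl _ z2.
  pose n := maxn N1 N2; have := h1 n (leq_maxl _ _); have := h2 n (leq_maxr _ _).
  have := slope_bound Ux Us (eU _ (he n)) sx (hx n).
  have := absv_split (slope x i (x 0 i + h n)) (slope x i s) l.
  have -> : s - (x 0 i + h n) = (s - x 0 i) - h n by ring.
  have := absv_subD (s - x 0 i) (h n); lra.
suff -> : partial f i x = l by exact: lim.
have lP : is_partial f i x l.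
  move=> z z0; exists (Num.min e z); first by rewrite lt_min e0.
  move=> g g0; rewrite lt_min => /andP[ge gz]; rewrite shift_upd.
  have gx : x 0 i + g - x 0 i = g by rewrite addrAC subrr add0r.
  have := lim _ (eU _ ge); rewrite -subr_eq0 gx /slope gx => /(_ g0).
  have := absv_ge0 g; lra.
rewrite /partial; case: xgetP => [m _ hm|/(_ l)//].
exact: is_partial_uniq hm lP.
Qed.

Lemma partial_linear x i (t : K) : U x -> Ui i t ->
  absv (f (upd x i t) - f x - partial f i x * (t - x 0 i)) <= 2^-1 * absv (t - x 0 i) ^+ 2.
Proof.
move=> Ux Ut; have [->|tx] := eqVneq t (x 0 i).
  by rewrite upd_id !subrr mulr0 subrr absv0 expr0n mulr0.
have tx' : t - x 0 i != 0 by rewrite subr_eq0.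
have -> : f (upd x i t) - f x - partial f i x * (t - x 0 i) =
    (slope x i t - partial f i x) * (t - x 0 i) by rewrite mulrBl divfK.
by rewrite absvM expr2 mulrA ler_pM2r ?absv_gt0 // slope_partial.
Qed.

(** For [i = j], adding the first-order expansions from both ends leaves the difference of the
    derivatives times the increment. For [i != j], both derivatives are replaced by slopes with a
    tiny increment [h], and the slopes differ by a mixed difference. *)
Lemma partial_upd x i j (t : K) : U x -> Ui j t ->
  absv (partial f i (upd x j t) - partial f i x) <= absv (t - x 0 j).
Proof.
move=> Ux Ut; have Ux' := obox_upd Ux Ut.
have [->|tx] := eqVneq t (x 0 j); first by rewrite upd_id !subrr.
have tx' : t - x 0 j != 0 by rewrite subr_eq0.
have tx0 : 0 < absv (t - x 0 j) by rewrite absv_gt0.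
have [->{i}|ij] := eqVneq i j.
  have := partial_linear Ux Ut; have := partial_linear Ux' (Ux j).
  rewrite upd_upd upd_id upd_eq (absvB (x 0 j) t).
  set p := partial f j x; set p' := partial f j (upd x j t) => h1 h2.
  rewrite -(ler_pM2r tx0) -absvM -expr2.
  set A := (X in absv X <= _) in h1; set B := (X in absv X <= _) in h2.
  have -> : (p' - p) * (t - x 0 j) = A + B by rewrite /A /B; ring.
  by apply: le_trans (absv_triangle _ _) _; lra.
apply/ler_addgt0Pr => z z0.
have [e e0 eU] := oball_near i Ux.
have [h h0] : exists2 h : K, h != 0 & absv h < Num.min e z.
  by apply: small_Qv; rewrite lt_min e0.
rewrite lt_min => /andP[he hz].
have Uh := eU h he; have xh : x 0 i + h - x 0 i = h by rewrite addrAC subrr add0r.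
have hx : x 0 i + h != x 0 i by rewrite -subr_eq0 xh.
have xi' : upd x j t 0 i = x 0 i by rewrite upd_neq.
have k1 := slope_partial Ux Uh hx.
have k2 : absv (slope (upd x j t) i (x 0 i + h) - partial f i (upd x j t)) <= 2^-1 * absv h.
  by rewrite -{2}xh -xi'; apply: slope_partial; rewrite ?xi'.
rewrite xh in k1.
have k3 : absv (slope (upd x j t) i (x 0 i + h) - slope x i (x 0 i + h)) <= 2^-1 * absv (t - x 0 j).
  have := mixed_dq_bound ij Ux Uh (Ux i) Ut (Ux j).
  rewrite /slope xi' xh upd_id -(updC x) 1?eq_sym //.
  have -> : upd (upd x i (x 0 i + h)) j (x 0 j) = upd x i (x 0 i + h).
    by rewrite -[x 0 j](@upd_neq x i j (x 0 i + h)) 1?eq_sym // upd_id.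
  rewrite upd_id => k; rewrite -mulrBl absvM absvV ler_pdivrMr ?absv_gt0 //.
  by rewrite mulrAC; apply: le_trans k; rewrite le_eqVlt; apply/orP; left;
    apply/eqP; congr absv; ring.
have := absv_split (slope (upd x j t) i (x 0 i + h)) (partial f i (upd x j t)) (partial f i x).
have := absv_split (slope x i (x 0 i + h)) (slope (upd x j t) i (x 0 i + h)) (partial f i x).
rewrite (absvB (partial f i (upd x j t)) (slope _ _ _)).
have := absv_ge0 (t - x 0 j); lra.
Qed.

(** Leads from [y] at [k = 0] to [x] at [k = d], changing one coordinate at a time; a box contains
    the whole path. *)
Definition path x y (k : nat) : 'rV[K]_d := \row_j (if (j < k)%N then x 0 j else y 0 j).

Lemma path_coord x y (k : 'I_d) : path x y k 0 k = y 0 k.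
Proof. by rewrite mxE ltnn. Qed.

Lemma path_in x y k : U x -> U y -> U (path x y k).
Proof. by move=> Ux Uy j; rewrite mxE; case: ifP. Qed.

Lemma path_sum (g : 'rV[K]_d -> K) x y :
  g x - g y = \sum_(k < d) (g (upd (path x y k) k (x 0 k)) - g (path x y k)).
Proof.
transitivity (g (path x y d) - g (path x y 0)).
  by congr (g _ - g _); apply/rowP => j; rewrite mxE ?ltn_ord.
rewrite -(telescope_sumr (fun k => g (path x y k)) (leq0n d)) big_mkord.
apply: eq_bigr => k _; congr (g _ - g _).
by apply/rowP => j; rewrite !mxE ltnS leq_eqVlt val_eqE; case: eqP => [->|].
Qed.

Lemma partial_lipschitz x y i : U x -> U y ->
  absv (partial f i x - partial f i y) <= \sum_j absv (x 0 j - y 0 j).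
Proof.
move=> Ux Uy; rewrite path_sum; apply: le_trans (absv_sum _ _ _) _.
apply: ler_sum => j _; rewrite -(path_coord x y j); apply: partial_upd => //.
exact: path_in.
Qed.

(** The derivative is frozen at [x0], yet the error is proportional to the distance of [x] and [y].
    This is what lets a small [rho] make the function nearly affine on a whole box. *)
Lemma linear_approx x0 x y (rho : R) : U x0 -> U x -> U y ->
  (forall j, absv (x 0 j - x0 0 j) <= rho) -> (forall j, absv (y 0 j - x0 0 j) <= rho) ->
  absv (f x - f y - \sum_j partial f j x0 * (x 0 j - y 0 j)) <=
    (d.+1)%:R * rho * \sum_j absv (x 0 j - y 0 j).
Proof.
move=> U0 Ux Uy hx hy; rewrite path_sum -sumrB mulr_sumr.
apply: le_trans (absv_sum _ _ _) _; apply: ler_sum => j _.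
have Up := path_in j Ux Uy; have := partial_linear Up (Ux j).
have : absv (partial f j (path x y j) - partial f j x0) <= d%:R * rho.
  apply: le_trans (partial_lipschitz _ _ _) _ => //.
  rewrite mulr_natl -[d in leRHS]card_ord -sumr_const; apply: ler_sum => k _.
  by rewrite mxE; case: ifP.
rewrite path_coord.
(* Bounds the quadratic error by [rho] times the increment; with [d * rho] for the drift of the
   derivative this gives the factor [d.+1]. *)
have xy : absv (x 0 j - y 0 j) <= rho + rho.
  by apply: le_trans (absv_split (x0 0 j) _ _) _; rewrite (absvB (x0 0 j)) lerD.
set q := partial f j x0; set p := partial f j _; set D := _ - f (path x y j).
move=> h1 h2.
have -> : D - q * (x 0 j - y 0 j) =
   (D - p * (x 0 j - y 0 j)) + (p - q) * (x 0 j - y 0 j) by ring.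
apply: le_trans (absv_triangle _ _) _; rewrite absvM -natr1.
have a0 := absv_ge0 (x 0 j - y 0 j).
have := ler_wpM2r a0 h1; have := ler_wpM2r a0 xy; rewrite -expr2; nra.
Qed.

End DifferenceQuotients.

(** * Strips inside a slab *)

Section NormV.
Context {R : realType} {v : place}.

Lemma sum_sqr_le (I : finType) (F : I -> R) : (forall i, 0 <= F i) ->
  \sum_i F i ^+ 2 <= (\sum_i F i) ^+ 2.
Proof.
move=> h; rewrite expr2 mulr_suml; apply: ler_sum => i _.
by rewrite expr2 ler_wpM2l // (bigD1 i) //= lerDl sumr_ge0.
Qed.

Lemma normv_le_sum m n (A : 'M[Qv R v]_(m, n)) : normv A <= \sum_i \sum_j absv (A i j).
Proof.
have row_ge0 i : 0 <= \sum_j absv (A i j) by apply: sumr_ge0 => j _; exact: absv_ge0.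
rewrite /normv; case: v A row_ge0 => [p|] A row_ge0.
  apply: bigmax_le; first exact: sumr_ge0.
  move=> i _; apply: (@le_trans _ _ (\sum_j absv (A i j))).
    apply: bigmax_le; first exact: row_ge0.
    by move=> j _; rewrite (bigD1 j) //= lerDl sumr_ge0 // => *; exact: (@absv_ge0 R (Some p)).
  by rewrite [leRHS](bigD1 i) //= lerDl; apply: sumr_ge0 => *; exact: row_ge0.
rewrite -[leRHS]ger0_norm ?sumr_ge0 // -sqrtr_sqr ler_wsqrtr //.
apply: le_trans (sum_sqr_le row_ge0); apply: ler_sum => i _.
by apply: (sum_sqr_le (F := fun j => absv (A i j))) => j; exact: (@absv_ge0 R None).
Qed.

Lemma normv_col_gt d (A : 'cV[Qv R v]_d) (g : R) : (0 < d)%N -> g < normv A ->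
  exists i, g / d%:R < absv (A i 0).
Proof.
move=> d0 gA; apply/not_existsP => h; have := lt_le_trans gA (normv_le_sum A).
apply/negP; rewrite -leNgt; apply: (@le_trans _ _ (\sum_(i < d) g / d%:R)).
  by apply: ler_sum => i _; rewrite big_ord1 leNgt; apply/negP/h.
by rewrite sumr_const card_ord -[X in X <= _]mulr_natr divfK // pnatr_eq0 -lt0n.
Qed.

Lemma normv_gt_open m n (A : 'M[Qv R v]_(m, n)) (g : R) : 0 <= g -> g < normv A ->
  exists2 e : R, 0 < e & forall B : 'M[Qv R v]_(m, n),
    (forall i j, absv (B i j - A i j) < e) -> g < normv B.
Proof.
case: v A => [p|] A g0 gA.
  have [i [j gij]] : exists i j, g < absv (A i j).
    apply/not_existsP => h; move: gA; apply/negP; rewrite -leNgt /normv.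
    by do 2!(apply: bigmax_le => // ? _); rewrite leNgt; apply/negP => hg; apply: h;
      eexists; exact: hg.
  exists (absv (A i j) - g); first by rewrite subr_gt0.
  move=> B hB; apply: lt_le_trans (absv_le_normv B i j).
  have := absv_lerB (A i j) (B i j); rewrite absvB; have := hB i j; lra.
rewrite /normv in gA *; set Q := fun A : 'M[Qv R None]_(m, n) => \sum_i \sum_j absv (A i j) ^+ 2.
have Q0 B : 0 <= Q B by do 2!(apply: sumr_ge0 => ? _); rewrite exprn_ge0 // absv_ge0.
have gE B : (g < Num.sqrt (Q B)) = (g ^+ 2 < Q B).
  by rewrite -(@ltr_pXn2r _ 2) ?nnegrE ?sqrtr_ge0 // sqr_sqrtr.
rewrite -/(Q A) gE in gA; pose s := \sum_i \sum_j absv (A i j).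
have s0 : 0 <= s by do 2!(apply: sumr_ge0 => ? _); exact: (@absv_ge0 R None).
have s1 : 0 < 2 * s + 1 by lra.
(* Perturbing the entries by less than [e] lowers [Q] by at most [2 * e * s]; the summand 1 keeps
   the denominator positive and leaves a surplus [e] for strictness. *)
pose e := (Q A - g ^+ 2) / (2 * s + 1).
have eE : e * (2 * s + 1) = Q A - g ^+ 2 by rewrite divfK // gt_eqF.
have e0 : 0 < e by rewrite divr_gt0 // subr_gt0.
exists e => // B hB; rewrite -/(Q B) gE.
have : Q A - 2 * e * s <= Q B; last by lra.
rewrite lerBlDr /s mulr_sumr -big_split; apply: ler_sum => i _ /=.
rewrite mulr_sumr -big_split; apply: ler_sum => j _ /=.
have hb := absv_lerB (A i j) (B i j); rewrite (absvB (A i j)) in hb.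
have hBij := hB i j; have sq := sqr_ge0 (absv (B i j) - absv (A i j)).
have : 0 <= absv (A i j) * (e - (absv (A i j) - absv (B i j))).
  by rewrite mulr_ge0 ?(@absv_ge0 R None) // subr_ge0; exact: ltW (le_lt_trans hb hBij).
by move: sq; rewrite /=; lra.
Qed.

End NormV.

(* The constant lost in the estimates below. It has to be 1 at every finite place,
   as it gets multiplied over S. *)
Definition count_factor (R : realType) (v : place) : R := if v is None then 6 else 1.

Section Slab.
Context {R : realType} {v : place}.

Lemma cell_dist (c x y : Qv R v) (w : R) : cell c w x -> cell c w y ->
  absv (x - y) <= ball_factor R v * w.
Proof.
rewrite /cell /= /ball_factor (absvB y); case: v c x y => [p|] c x y hx hy.
  rewrite mul1r; have := @absv_ultra R (Some p) (x - c) (c - y) isT.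
  by rewrite addrA subrK => /le_trans -> //; rewrite ge_max hx.
by apply: le_trans (absv_split c x y) _; lra.
Qed.

(** Limits the spread of the S-integers near the values of [F] on a slab. Over the reals the terms
    add up to at most 5.5 times [a * w]; at a finite place each term is at most [a * w], and so is
    their sum. *)
Lemma slab_range (a w e t : R) (Fx Fy z z' D X : Qv R v) :
  0 < a -> absv D = a -> absv (Fx - Fy - D * X) <= a / 2 * absv X + t ->
  absv X <= ball_factor R v * w -> t <= a * w / 2 -> e <= a * w ->
  absv (Fx - z) < e -> absv (Fy - z') < e ->
  absv (z - z') <= count_factor R v * (a * w).
Proof.
rewrite (absvB Fx) /ball_factor /count_factor => a0 Da.
case: v Fx Fy z z' D X Da => [p|] Fx Fy z z' D X Da hF hX ht he hz hz'.
  rewrite !mul1r in hX *; set E := Fx - Fy - D * X in hF.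
  have aX : a * absv X <= a * w by rewrite ler_pM2l.
  have hE : absv E <= a * w by lra.
  have hD : absv (D * X) <= a * w by rewrite absvM Da.
  have u s t' : absv s <= a * w -> absv t' <= a * w -> absv (s + t' : Qv R (Some p)) <= a * w.
    by move=> hs ht'; apply: le_trans (@absv_ultra R (Some p) s t' isT) _; rewrite ge_max hs.
  have -> : z - z' = (z - Fx) + ((E + D * X) + (Fy - z')) by rewrite /E; ring.
  by apply: (u); [lra|apply: (u); [exact: (u)|lra]].
set E := Fx - Fy - D * X in hF.
have -> : z - z' = (z - Fx) + ((E + D * X) + (Fy - z')) by rewrite /E; ring.
have h1 := absv_triangle (z - Fx) ((E + D * X) + (Fy - z')).
have h2 := absv_triangle (E + D * X) (Fy - z'); have h3 := absv_triangle E (D * X).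
have aX : a * absv X <= a * (2 * w) by rewrite ler_pM2l.
rewrite absvM Da in h3.
have e0 := le_lt_trans (absv_ge0 _) hz.
suff : absv (z - Fx + (E + D * X + (Fy - z'))) <= 6 * (a * w) by [].
lra.
Qed.

(** Limits the distance of two points belonging to the same [z]. Half of [a * absv X] is absorbed on
    the left, which leaves at most 4.5 times [e] over the reals and less than [e] at a finite
    place. *)
Lemma slab_strip (a e t : R) (Fx Fy z D X : Qv R v) :
  0 < a -> absv D = a -> absv (Fx - Fy - D * X) <= a / 2 * absv X + t ->
  t <= e / 4 -> absv (Fx - z) < e -> absv (Fy - z) < e ->
  absv X < count_factor R v * (e / a).
Proof.
move=> a0; rewrite (absvB Fy) mulrA ltr_pdivlMr // /count_factor => Da.
case: v Fx Fy z D X Da => [p|] Fx Fy z D X Da hF ht hz hz'.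
  rewrite mul1r; set E := Fx - Fy - D * X in hF.
  have e0 := le_lt_trans (absv_ge0 _) hz.
  have h1 : absv (Fx - Fy) < e.
    have := @absv_ultra R (Some p) (Fx - z) (z - Fy) isT.
    by rewrite addrA subrK => /le_lt_trans; apply; rewrite gt_max hz.
  have := @absv_ultra R (Some p) (- E) (Fx - Fy) isT.
  have -> : - E + (Fx - Fy) = D * X by rewrite /E; ring.
  by rewrite absvM Da absvN mulrC le_max => /orP[h|h]; lra.
set E := Fx - Fy - D * X in hF.
have h2 := absv_triangle (- E) ((Fx - z) + (z - Fy)).
have h3 := absv_triangle (Fx - z) (z - Fy).
have EE : - E + ((Fx - z) + (z - Fy)) = D * X by rewrite /E; ring.
rewrite EE absvM Da absvN in h2.
have e0 := le_lt_trans (absv_ge0 _) hz.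
suff : absv X * a < 6 * e by [].
lra.
Qed.

Lemma strip_radius (E : R) : 0 < E -> exists s, [/\ value_radius v s,
  s <= count_factor R v * E &
  forall x : Qv R v, absv x < count_factor R v * E -> absv x <= s].
Proof.
move=> E0; have [|s [hs sE _ h]] := @floor_radius R v (count_factor R v * E).
  by rewrite mulr_gt0 // /count_factor; case: v.
by exists s.
Qed.

End Slab.

(** * Measure of a strip *)

Lemma exists_pow_small (R : realType) (b : nat) (M t : R) : (1 < b)%N -> 0 < t ->
  exists k, M / b%:R ^+ k <= t.
Proof.
move=> b1 t0; pose k := (Num.truncn (M / t)).+1; exists k.
have bk : (k < b ^ k)%N by exact: ltn_expl.
rewrite ler_pdivrMr ?exprn_gt0 ?ltr0n ?(ltnW b1) // mulrC -ler_pdivrMr //.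
apply: le_trans (ltW (truncnS_gt _)) _.
by rewrite -natrX ler_nat ltnW.
Qed.

(** Take the first level at or below [t]; minimality keeps it within a factor [b] of [t]. *)
Lemma exists_level (R : realType) (b : nat) (w t : R) : (1 < b)%N -> 0 < t -> t <= w ->
  exists k, w / b%:R ^+ k <= t /\ t / b%:R <= w / b%:R ^+ k.
Proof.
move=> b1 t0 tw; have b0 : 0 < b%:R :> R by rewrite ltr0n ltnW.
have ex : exists k, w / b%:R ^+ k <= t by exact: exists_pow_small.
case: (ex_minnP ex) => k hk kmin; exists k; split=> //.
case: k hk kmin => [_ _|k _ kmin].
  by rewrite expr0 divr1; apply: le_trans tw; rewrite ler_pdivrMr // ler_peMr ?(ltW t0) // ler1n ltnW.
rewrite exprSr invfM mulrA ler_pM2r ?invr_gt0 // leNgt; apply/negP => h.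
by have := kmin k (ltW h); rewrite ltnn.
Qed.

Section StripMeasure.
Context {R : realType} {S : {fset place}} (hS : None \in S) {d : S -> nat}.
Context (mu_ : forall v : S, {measure set (Qv_borel R (val v)) -> \bar R}).
Context (hmu_ : forall v, is_mu_v (mu_ v)).
Context (mu : {measure set (QSpace_borel R d) -> \bar R}).
Context (hmu : is_product_measure mu_ mu).
Context (F : forall v : S, 'rV[Qv R (val v)]_(d v) -> Qv R (val v)).
Context (e : R) (e0 : 0 < e).

Lemma prod_count_factor : \prod_(v : S) count_factor R (val v) = 6.
Proof.
rewrite (bigD1 [` hS]%fset) //= big1 ?mulr1 // => v vN; rewrite /count_factor.
by case E : (val v) => [//|]; move: vN; rewrite -val_eqE /= E eqxx.
Qed.

(* [iv v] is the direction in which [F v] has derivative about [D v]; the thinness of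
   the slab in the other directions is hidden in the error term [th]. *)
Lemma slab_measure (E : set (QSpace_borel R d)) (mE : measurable E)
    (c : QSpace R d) (w : forall v : S, 'I_(d v) -> R)
    (hw : forall v i, value_radius (val v) (w v i)) (Ebox : E `<=` box c w)
    (iv : forall v, 'I_(d v)) (D : forall v : S, Qv R (val v)) (th : S -> R) :
  (forall v, D v != 0) ->
  (forall x y, E x -> E y -> forall v,
    absv (F (x v) - F (y v) - D v * (x v 0 (iv v) - y v 0 (iv v))) <=
    absv (D v) / 2 * absv (x v 0 (iv v) - y v 0 (iv v)) + th v) ->
  (forall v, th v <= e / 4) -> (forall v, th v <= absv (D v) * w v (iv v) / 2) ->
  (forall v, e <= absv (D v) * w v (iv v)) -> 1 <= \prod_v (absv (D v) * w v (iv v)) ->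
  (forall x, E x -> exists2 z, S_integer R S z & forall v, absv (F (x v) - ratr z) < e) ->
  (mu E <= (108 * e ^+ #|` S| * vol w)%:E)%E.
Proof.
move=> D0 hF th4 thw ew prod1 hz.
have w0 v i : 0 < w v i := value_radius_gt0 (hw v i).
have a0 v : 0 < absv (D v) by rewrite absv_gt0.
have [[x1 Ex1]|E0] := pselect (exists x, E x); last first.
  have -> : E = set0 by apply/seteqP; split=> x // Ex; case: E0; exists x.
  by rewrite measure0 lee_fin !mulr_ge0 ?exprn_ge0 ?(ltW e0) // ltW // vol_gt0.
(* Only differences of S-integers are bounded on the slab, so all [z] are counted relative to
   [z1]. *)
have [z1 z1S hz1] := hz _ Ex1.
have vr v : value_radius (val v) (count_factor R (val v) * (absv (D v) * w v (iv v))).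
  apply: value_radiusM; last by apply: value_radiusM => //; exact: value_radius_absv.
  by rewrite /count_factor; case: (val v) => [p|] /=; [exists 0|rewrite ltr0n].
have [s [ssize hs]] := S_integer_count hS vr.
have hstrip (v : S) := @strip_radius R (val v) (e / absv (D v)) (divr_gt0 e0 (a0 v)).
pose sv (v : S) : R := projT1 (cid (hstrip v)).
have svr v : value_radius (val v) (sv v) by have [] := projT2 (cid (hstrip v)).
have svle v : sv v <= count_factor R (val v) * (e / absv (D v)).
  by have [] := projT2 (cid (hstrip v)).
have svx v (x : Qv R (val v)) : absv x < count_factor R (val v) * (e / absv (D v)) ->
    absv x <= sv v by have [_ _] := projT2 (cid (hstrip v)); exact.
pose ws v i := w v i * (if i == iv v then sv v / w v (iv v) else 1).
have wsE v : ws v (iv v) = sv v by rewrite /ws eqxx mulrC divfK // gt_eqF.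
(* The sub-box of [z] is centred, in the directions [iv], at any one point belonging to [z]; if
   there is none, the centre is arbitrary. *)
have /choice[cz hcz] (z : rat) : exists cz : QSpace R d, forall y, E y ->
    (forall v, absv (F (y v) - ratr z) < e) -> box cz ws y.
  have [[x [Ex xz]]|no] := pselect (exists x, E x /\ forall v, absv (F (x v) - ratr z) < e);
    last by exists c => y Ey yz; case: no; exists y.
  exists (fun v => upd (c v) (iv v) (x v 0 (iv v))) => y Ey yz v i.
  have [->|iiv] := eqVneq i (iv v).
    rewrite upd_eq wsE; apply: svx.
    exact: slab_strip (a0 v) erefl (hF y x Ey Ex v) (th4 v) (yz v) (xz v).
  by rewrite upd_neq // /ws (negbTE iiv) mulr1; exact: Ebox.
have wsr v i : value_radius (val v) (ws v i).
  rewrite /ws; case: eqP => [->|_]; last by rewrite mulr1.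
  by rewrite mulrC divfK // gt_eqF.
have cov : (mu E <= \sum_(z <- [seq (z1 + t)%R | t <- s]) mu (box (cz z) ws))%E.
  apply: measure_le_sum => //; first by move=> i; exact: measurable_box.
  move=> x Ex; have [z zS zx] := hz _ Ex.
  exists z; last exact: hcz.
  apply/mapP; exists (z - z1); last by rewrite addrC subrK.
  apply: hs.
    move=> v vS; case: v vS => [p|] vS; last by move: vS; rewrite hS.
    have := zS _ vS; have := z1S _ vS; rewrite /place_abs => h1 h2.
    have pp := valP p; apply: le_trans (padic_norm_ultra R pp _ _) _.
    have -> : padic_norm R (val p) (- z1) = padic_norm R (val p) z1.
      exact: (avN (padic_absval R pp)).
    by rewrite ge_max h1 h2.
  move=> v; rewrite -absv_ratr ratr_QvB.
  have dX : absv (x v 0 (iv v) - x1 v 0 (iv v)) <= ball_factor R (val v) * w v (iv v).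
    by apply: (@cell_dist R (val v) (c v 0 (iv v))); apply: Ebox.
  exact: (slab_range (a0 v) erefl (hF x x1 Ex Ex1 v) dX (thw v) (ew v) (zx v) (hz1 v)).
apply: (le_trans cov); rewrite (eq_bigr (fun=> (vol ws)%:E)); last by move=> z _; exact: (box_measure hmu_ hmu).
rewrite sumEFin lee_fin big_const_seq count_predT size_map iter_addr_0 -[X in X <= _]mulr_natr.
rewrite /ws volM.
have -> : \prod_v \prod_i (if i == iv v then sv v / w v (iv v) else 1) =
    \prod_v (sv v / w v (iv v)).
  by apply: eq_bigr => v _; rewrite -big_mkcond big_pred1_eq.
rewrite -[leLHS]mulrA [leRHS]mulrC ler_pM2l ?vol_gt0 //.
set W := \prod_v (absv (D v) * w v (iv v)) in prod1.
have W0 : 0 < W by apply: lt_le_trans prod1.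
(* The count is at most [2 * 6 * W + 1], and [W >= 1] absorbs the 1. Together with the factor 6 in
   [hsv] this gives 108, and [W] cancels. *)
have hsize : (size s)%:R <= 18 * W.
  apply: le_trans ssize _; rewrite big_split /= prod_count_factor; rewrite -/W; lra.
have hsv : \prod_v (sv v / w v (iv v)) <= 6 * e ^+ #|` S| / W.
  apply: (@le_trans _ _ (\prod_v (count_factor R (val v) * (e / (absv (D v) * w v (iv v)))))).
    apply: ler_prod => v _; rewrite divr_ge0 ?(ltW (value_radius_gt0 (svr v))) ?(ltW (w0 _ _)) //=.
    by rewrite invfM !mulrA ler_pM2r ?invr_gt0 // -mulrA.
  rewrite big_split /= prod_count_factor big_split /= prodfV -/W prodr_const.
  by rewrite -cardfE mulrA.
apply: le_trans (ler_pM _ _ hsv hsize) _ => //.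
  by apply: prodr_ge0 => v _; rewrite divr_ge0 ?(ltW (value_radius_gt0 (svr v))) ?(ltW (w0 _ _)).
by rewrite le_eqVlt; apply/orP; left; apply/eqP; field; rewrite gt_eqF.
Qed.


(** Here [D] stands for the gradient, [L] for the bound on its variation, [g] for the lower bound on
    one of its entries and [rho] for the side of the first grid. The condition on [L] keeps the
    variation of [D] below half of its large entry. *)
Lemma strip_measure (U : forall v : S, set 'rV[Qv R (val v)]_(d v))
    (D : forall v : S, 'rV[Qv R (val v)]_(d v) -> 'I_(d v) -> Qv R (val v))
    (L g rho : S -> R) :
  (forall v, 0 <= L v) -> (forall v, 0 < g v) -> (forall v, 0 < rho v) ->
  (forall v x0 x y (t : R), U v x0 -> U v x -> U v y ->
     (forall j, absv (x 0 j - x0 0 j) <= t) -> (forall j, absv (y 0 j - x0 0 j) <= t) ->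
     absv (F x - F y - \sum_j D v x0 j * (x 0 j - y 0 j)) <=
       L v * t * \sum_j absv (x 0 j - y 0 j)) ->
  (forall v, L v * (2 * rho v) <= g v / 2) ->
  (forall v, e <= g v * (rho v / (place_base (val v))%:R)) ->
  1 <= \prod_v (g v * (rho v / (place_base (val v))%:R)) ->
  forall (E : set (QSpace_borel R d)) (mE : measurable E) (c : QSpace R d)
    (w : forall v : S, 'I_(d v) -> R),
  (forall v i, value_radius (val v) (w v i)) -> (forall v i, rho v <= w v i) ->
  E `<=` box c w -> (forall x, E x -> forall v, U v (x v)) ->
  (forall x, E x -> forall v, exists i, g v < absv (D v (x v) i)) ->
  (forall x, E x -> exists2 z, S_integer R S z & forall v, absv (F (x v) - ratr z) < e) ->
  (mu E <= (108 * e ^+ #|` S| * vol w)%:E)%E.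
Proof.
move=> L0 g0 r0 happ hLg he hprod E mE c w hw rw Ebox EU hgrad hz.
have kap0 : 0 <= 108 * e ^+ #|` S| by rewrite mulr_ge0 // exprn_ge0 // ltW.
have b1 (v : S) := place_base_gt1 (val v).
have /(_ _ _)/cid hk (v : S) i : exists k, w v i / (place_base (val v))%:R ^+ k <= rho v /\
    rho v / (place_base (val v))%:R <= w v i / (place_base (val v))%:R ^+ k.
  exact: exists_level.
pose k v i := projT1 (hk v i).
pose wm v i := w v i / (place_base (val v))%:R ^+ k v i.
have wmr v i : value_radius (val v) (wm v i) by exact: value_radius_divX.
have wm0 v i : 0 < wm v i := value_radius_gt0 (wmr v i).
have wm1 v i : wm v i <= rho v by have [] := projT2 (hk v i).
have wm2 v i : rho v / (place_base (val v))%:R <= wm v i by have [] := projT2 (hk v i).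
have -> : E = E `&` box c w by rewrite setIidl.
apply: (box_refine mE hw (k := k)) => {Ebox} {}c.
rewrite -/wm; set Q := E `&` box c wm.
have mQ : measurable Q by apply: measurableI => //; exact: measurable_box.
have [[x0 Qx0]|Q0] := pselect (exists x, Q x); last first.
  have -> : Q = set0 by apply/seteqP; split=> x // Qx; case: Q0; exists x.
  by rewrite measure0 lee_fin mulr_ge0 // ltW // vol_gt0.
have [Ex0 Bx0] := Qx0.
(* The directions and the derivatives are read off at the single point [x0] and kept for the whole
   box. *)
have /(_ _)/cid hiv (v : S) := hgrad _ Ex0 v.
pose iv v := projT1 (hiv v).
pose Dv v := D v (x0 v) (iv v).
have ga v : g v < absv (Dv v) := projT2 (hiv v).
have a0 v : 0 < absv (Dv v) := lt_trans (g0 v) (ga v).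
(* What a displacement in the other coordinates can contribute: the linearisation error plus the
   remaining entries of the gradient. *)
pose M v := absv (Dv v) / 2 + \sum_j absv (D v (x0 v) j).
have M0 v : 0 <= M v by rewrite addr_ge0 ?divr_ge0 ?absv_ge0 // sumr_ge0 // => *; exact: absv_ge0.
pose th v := Num.min (e / 4) (absv (Dv v) * wm v (iv v) / 2).
have th0 v : 0 < th v by rewrite lt_min !divr_gt0 // mulr_gt0 //; exact: wm0.
have /(_ _)/cid hK (v : S) : exists K, M v * ((d v)%:R * (2 * rho v)) / (place_base (val v))%:R ^+ K <= th v.
  exact: exists_pow_small.
pose K v := projT1 (hK v).
(* The second grid leaves the direction [iv v] uncut and is so fine in the others that their
   contribution drops below [th v]. *)
pose kt v i := if i == iv v then 0%N else K v.
have -> : mu Q = mu (Q `&` box c wm) by congr (mu _); rewrite setIidl // => x [].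
apply: (box_refine mQ wmr (k := kt)) => c'.
pose wt v i := wm v i / (place_base (val v))%:R ^+ kt v i.
rewrite -/wt; set B := Q `&` box c' wt.
have mB : measurable B by apply: measurableI => //; exact: measurable_box.
have wtr v i : value_radius (val v) (wt v i) by exact: value_radius_divX.
have wtiv v : wt v (iv v) = wm v (iv v) by rewrite /wt /kt eqxx expr0 divr1.
have wtn v i : i != iv v -> 2 * wt v i <= 2 * rho v / (place_base (val v))%:R ^+ K v.
  move=> /negbTE ii; rewrite /wt /kt ii -mulrA ler_pM2l // ler_pM2r ?wm1 //.
  by rewrite invr_gt0 exprn_gt0 // place_base_gt0.
have hB x : B x -> [/\ E x, box c wm x & box c' wt x] by move=> [[]].
have eg v : g v * (rho v / (place_base (val v))%:R) <= absv (Dv v) * wm v (iv v).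
  apply: ler_pM => //; first exact: ltW.
    by rewrite divr_ge0 // ltW // r0.
  exact: ltW.
have bf2 (v : S) : ball_factor R (val v) <= 2.
  by case: (val v) => [p|]; rewrite /ball_factor // ler1n.
have close (v : S) (c1 x y : Qv R (val v)) (u : R) : 0 <= u -> cell c1 u x -> cell c1 u y ->
    absv (x - y) <= 2 * u.
  by move=> u0 hx hy; apply: le_trans (cell_dist hx hy) _; rewrite ler_wpM2r.
apply: (@slab_measure B mB c' wt wtr _ iv Dv th).
- by move=> x /hB[].
- by move=> v; rewrite -absv_gt0.
- move=> x y /hB[Ex bx b'x] /hB[Ey by_ b'y] v.
  (* [x0] need not be the centre of the box, hence the diameter and the factor 2 in the condition on
     [L]. *)
  have near0 x' : box c wm x' -> forall j, absv (x' v 0 j - x0 v 0 j) <= 2 * rho v.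
    move=> bx' j; apply: le_trans (close v (c v 0 j) _ _ _ (ltW (wm0 v j)) (bx' v j) (Bx0 v j)) _.
    by rewrite ler_pM2l.
  have := happ v (x0 v) (x v) (y v) _ (EU _ Ex0 v) (EU _ Ex v) (EU _ Ey v) (near0 _ bx) (near0 _ by_).
  rewrite (bigD1 (iv v)) //= -/(Dv v) [\sum_j absv _](bigD1 (iv v)) //=.
  set X := x v 0 (iv v) - y v 0 (iv v); set s1 := \sum_(j | _) _; set s2 := \sum_(j | _) _ => h.
  have La : L v * (2 * rho v) <= absv (Dv v) / 2.
    by apply: le_trans (hLg v) _; rewrite ler_pM2r // ltW.
  have s20 : 0 <= s2 by apply: sumr_ge0 => *; exact: absv_ge0.
  have h1 : absv s1 <= (\sum_j absv (D v (x0 v) j)) * s2.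
    apply: le_trans (absv_sum _ _ _) _; rewrite mulr_sumr; apply: ler_sum => j _.
    rewrite absvM ler_wpM2r ?absv_ge0 // (bigD1 j) //= lerDl.
    by apply: sumr_ge0 => *; exact: absv_ge0.
  have h2 : M v * s2 <= th v.
    apply: le_trans (projT2 (hK v)); rewrite -!mulrA ler_wpM2l //.
    apply: (@le_trans _ _ (\sum_(j | j != iv v) 2 * rho v / (place_base (val v))%:R ^+ K v)).
      apply: ler_sum => j ji; apply: le_trans (wtn v j ji).
      exact: close (ltW (value_radius_gt0 (wtr v j))) (b'x v j) (b'y v j).
    rewrite sumr_const -[X in X <= _]mulr_natl -!mulrA ler_wpM2r //; last first.
      by rewrite ler_nat -[leqRHS]card_ord max_card.
    by rewrite mulr_ge0 // divr_ge0 ?(ltW (r0 v)) // exprn_ge0.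
  have -> : F (x v) - F (y v) - Dv v * X = (F (x v) - F (y v) - (Dv v * X + s1)) + s1 by ring.
  apply: le_trans (absv_triangle _ _) _.
  have h3 := ler_wpM2r (addr_ge0 (absv_ge0 X) s20) La.
  have := le_trans h h3; rewrite /M mulrDl in h2; rewrite mulrDr; lra.
- by move=> v; rewrite /th ge_min lexx.
- by move=> v; rewrite wtiv /th ge_min lexx orbT.
- by move=> v; rewrite wtiv; apply: le_trans (he v) (eg v).
- apply: le_trans hprod _; apply: ler_prod => v _; rewrite wtiv eg andbT.
  by rewrite mulr_ge0 ?divr_ge0 ?(ltW (g0 v)) ?(ltW (r0 v)).
- by move=> x /hB[Ex _ _]; exact: hz.
Qed.

End StripMeasure.

Lemma normv_ge0 (R : realType) (v : place) m n (A : 'M[Qv R v]_(m, n)) : 0 <= normv A.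
Proof.
rewrite /normv; case: v A => [p|] A; last exact: sqrtr_ge0.
by elim/big_rec: _ => // i x _ x0; rewrite le_max x0 orbT.
Qed.

(** * Linear forms in the components of the map *)

Section LinearForm.
Context {R : realType} {v : place} {d n : nat}.
Local Notation K := (Qv R v).
Context (c : 'rV[K]_d) (r : 'I_d -> R) (f : 'rV[K]_d -> 'rV[K]_n).
Local Notation U := (obox c r).
Hypothesis hdq : forall (j : 'I_n) (beta : 'I_d -> nat), (\sum_i beta i)%N = 2%N ->
  let Ui i := oball (c 0 i) (r i) in
  exists2 G, is_dq_extension Ui beta (fun x => f x 0 j) G &
    forall y, dq_dom Ui beta y -> absv (G y) <= 2^-1.
Context (q : 'cV[K]_n).

Lemma lform_approx (H : R) (qH : forall k, absv (q k 0) <= H) x0 x y (t : R) : U x0 -> U x -> U y ->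
  (forall j, absv (x 0 j - x0 0 j) <= t) -> (forall j, absv (y 0 j - x0 0 j) <= t) ->
  absv ((f x *m q) 0 0 - (f y *m q) 0 0 -
        \sum_j (gradient f x0 *m q) j 0 * (x 0 j - y 0 j)) <=
    n%:R * H * d.+1%:R * t * \sum_j absv (x 0 j - y 0 j).
Proof.
move=> U0 Ux Uy hx hy.
pose T k := f x 0 k - f y 0 k -
  \sum_j partial (fun z => f z 0 k) j x0 * (x 0 j - y 0 j).
have -> : (f x *m q) 0 0 - (f y *m q) 0 0 -
    \sum_j (gradient f x0 *m q) j 0 * (x 0 j - y 0 j) = \sum_k T k * q k 0.
  rewrite !mxE -sumrB.
  rewrite [X in _ - X](_ : _ = \sum_k
    (\sum_j partial (fun z => f z 0 k) j x0 * (x 0 j - y 0 j)) * q k 0); last first.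
    under eq_bigr => j _ do rewrite mxE mulr_suml.
    rewrite exchange_big; apply: eq_bigr => k _ /=; rewrite mulr_suml.
    by apply: eq_bigr => j _; rewrite mxE mulrAC.
  by rewrite -sumrB; apply: eq_bigr => k _; rewrite /T !mulrBl.
set s := \sum_j absv _.
apply: le_trans (absv_sum _ _ _) _.
apply: (@le_trans _ _ (\sum_(k < n) (d.+1%:R * t * s) * H)).
  apply: ler_sum => k _; rewrite absvM; apply: ler_pM; rewrite ?absv_ge0 //.
  exact: (linear_approx (hdq k)).
by rewrite sumr_const card_ord -[X in X <= _]mulr_natl !mulrA [_ * H]mulrC !mulrA [H * _]mulrC.
Qed.

Lemma lgrad_lipschitz (H : R) (qH : forall k, absv (q k 0) <= H) x y i : U x -> U y ->
  absv ((gradient f x *m q) i 0 - (gradient f y *m q) i 0) <=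
    n%:R * H * \sum_j absv (x 0 j - y 0 j).
Proof.
move=> Ux Uy; set s := \sum_j absv _.
rewrite !mxE -sumrB; apply: le_trans (absv_sum _ _ _) _.
apply: (@le_trans _ _ (\sum_(k < n) s * H)).
  apply: ler_sum => k _; rewrite -mulrBl absvM; apply: ler_pM; rewrite ?absv_ge0 //.
  by rewrite !mxE; exact: (partial_lipschitz (hdq k)).
by rewrite sumr_const card_ord -[X in X <= _]mulr_natl [s * H]mulrC mulrA.
Qed.

(** The reciprocal of a sum of reciprocals serves as a minimum and also makes sense for an empty
    [I]. *)
Lemma finite_lower_bound (I : finType) (s : I -> R) : (forall i, 0 < s i) ->
  exists2 t, 0 < t & forall i, t <= s i.
Proof.
move=> s0; have t0 : 0 < 1 + \sum_i (s i)^-1.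
  by rewrite ltr_pwDl // sumr_ge0 // => i _; rewrite invr_ge0 ltW.
exists (1 + \sum_i (s i)^-1)^-1; first by rewrite invr_gt0.
move=> i; rewrite -[s i]invrK lef_pV2 ?posrE ?invr_gt0 // (bigD1 i) //= addrCA lerDl.
by rewrite addr_ge0 // sumr_ge0 // => j _; rewrite invr_ge0 ltW.
Qed.

Lemma lform_open x (e : R) : U x -> 0 < e -> exists2 t, 0 < t &
  forall y, normv (y - x) < t ->
    [/\ U y, absv ((f y *m q) 0 0 - (f x *m q) 0 0) < e &
        forall i, absv ((gradient f y *m q) i 0 - (gradient f x *m q) i 0) < e].
Proof.
move=> Ux e0.
pose H := \sum_k absv (q k 0).
have H0 : 0 <= H by apply: sumr_ge0 => *; exact: absv_ge0.
have qH k : absv (q k 0) <= H.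
  by rewrite /H (bigD1 k) //= lerDl; apply: sumr_ge0 => *; exact: absv_ge0.
have [t0 t00 ht0] := @finite_lower_bound _ (fun i => r i - absv (x 0 i - c 0 i))
  ltac:(by move=> i; rewrite subr_gt0; exact: Ux).
pose G := n%:R * H * d.+1%:R + n%:R * H + \sum_j absv ((gradient f x *m q) j 0).
have nH : 0 <= n%:R * H by rewrite mulr_ge0.
have D0 : 0 <= \sum_j absv ((gradient f x *m q) j 0).
  by apply: sumr_ge0 => *; exact: absv_ge0.
have G0 : 0 <= G by rewrite !addr_ge0 // mulr_ge0.
pose B := G * d%:R + 1; have B0 : 0 < B by rewrite ltr_wpDl // mulr_ge0.
(* Respectively: stay in [U], make [lform_approx] applicable with [t = 1], and beat the Lipschitz
   constant [G] summed over the coordinates. *)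
exists (Num.min t0 (Num.min 1 (e / B))).
  by rewrite !lt_min t00 ltr01 divr_gt0.
move=> y; rewrite !lt_min => /and3P[y0 y1 ye].
have yx i : absv (y 0 i - x 0 i) <= normv (y - x).
  by have := absv_le_normv (y - x) 0 i; rewrite !mxE.
have Uy : U y.
  move=> i; rewrite /oball /=; apply: le_lt_trans (absv_split (x 0 i) _ _) _.
  by have := ht0 i; have := yx i; lra.
have sum_lt : G * \sum_j absv (y 0 j - x 0 j) < e.
  apply: (@le_lt_trans _ _ (G * d%:R * normv (y - x))).
    rewrite -mulrA ler_wpM2l // mulr_natl -[X in _ *+ X]card_ord -sumr_const.
    by apply: ler_sum => j _.
  move: ye; rewrite ltr_pdivlMr // mulrC /B => ye; apply: le_lt_trans ye.
  by rewrite ler_wpM2r ?lerDl // normv_ge0.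
have s0 : 0 <= \sum_j absv (y 0 j - x 0 j) by apply: sumr_ge0 => *; exact: absv_ge0.
have yx1 j : absv (y 0 j - x 0 j) <= 1 by apply: le_trans (yx j) (ltW y1).
split=> // [|i].
  have hx j : absv (x 0 j - x 0 j) <= 1 by rewrite subrr absv0.
  have := lform_approx qH Ux Uy Ux yx1 hx; rewrite mulr1.
  set A := (f y *m q) 0 0 - _; set s1 := \sum_j _ * _ => hA.
  have hs1 : absv s1 <= (\sum_j absv ((gradient f x *m q) j 0)) * \sum_j absv (y 0 j - x 0 j).
    apply: le_trans (absv_sum _ _ _) _; rewrite mulr_sumr; apply: ler_sum => j _.
    rewrite absvM ler_wpM2r ?absv_ge0 // (bigD1 j) //= lerDl.
    by apply: sumr_ge0 => *; exact: absv_ge0.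
  rewrite -(subrK s1 A); apply: le_lt_trans (absv_triangle _ _) _.
  apply: le_lt_trans sum_lt; rewrite /G !mulrDl; have := mulr_ge0 nH s0; lra.
apply: le_lt_trans (lgrad_lipschitz qH i Uy Ux) _; apply: le_lt_trans sum_lt.
by rewrite ler_wpM2r // /G -addrA addrCA lerDl addr_ge0 // mulr_ge0.
Qed.

End LinearForm.

(** * The set attached to one vector q, and the sum over q *)

Lemma powR_unbounded (R : realType) (a p : R) : 0 < p ->
  exists2 M : R, 1 <= M & forall N, M <= N -> a <= N `^ p.
Proof.
move=> p0; exists (Num.max 1 (Num.max 0 a `^ p^-1)); first by rewrite le_max lexx.
move=> N; rewrite ge_max => /andP[N1 Na].
apply: (@le_trans _ _ (Num.max 0 a)); first by rewrite le_max lexx orbT.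
have a0 : 0 <= Num.max 0 a by rewrite le_max lexx.
rewrite -[leLHS]powRr1 // -(mulVf (lt0r_neq0 p0)) powRrM.
by apply: ge0_ler_powR; rewrite ?nnegrE ?powR_ge0 ?(ltW p0) // (le_trans ler01).
Qed.

(** The Cartesian product of a list of lists; it will enumerate the vectors [q] from lists for their
    entries. *)
Definition choices (T : eqType) (ss : seq (seq T)) : seq (seq T) :=
  foldr (fun s acc => [seq x :: l | x <- s, l <- acc]) [:: [::]] ss.

Lemma size_choices (T : eqType) (ss : seq (seq T)) :
  size (choices ss) = (\prod_(s <- ss) size s)%N.
Proof.
elim: ss => [|s ss IH]; first by rewrite big_nil.
by rewrite big_cons /= size_allpairs IH.
Qed.

Lemma mem_choices (T I : eqType) (s : I -> seq T) (q : I -> T) (e : seq I) :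
  (forall i, i \in e -> q i \in s i) -> [seq q i | i <- e] \in choices [seq s i | i <- e].
Proof.
elim: e => [|i e IH] h /=; first by rewrite inE.
apply: allpairs_f; first by apply: h; rewrite inE eqxx.
by apply: IH => j je; apply: h; rewrite inE je orbT.
Qed.

(** * Size and number of S-integers, distance to them *)

Section SIntegers.
Context {R : realType} (S SR : {fset place}) (hSR : (SR `<=` S)%fset) (hSR0 : None \in SR).

Lemma absS_ge (v : place) (q : rat) : v \in S -> place_abs R v q <= absS R S q.
Proof. by move=> vS; exact: (le_bigmax 0 (fun u : S => place_abs R (val u) q) [` vS]%fset). Qed.

(** With all absolute values over [S] below 1, [q] would be integral at every prime, hence an
    integer of real absolute value below 1. *)
Lemma S_integer_absS_ge1 (q : rat) : q != 0 -> S_integer R SR q -> 1 <= absS R S q.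
Proof.
move=> q0 qS; rewrite leNgt; apply/negP => q1; have [v|m qm] := @padic_integer_int R q.
  move=> pv; pose L : place := Some (exist _ v pv : {p : nat | prime p}).
  have [LS|LS] := boolP (L \in SR); last exact: (qS L).
  by apply: ltW; apply: le_lt_trans q1; exact: (@absS_ge L q (fsubsetP hSR _ LS)).
have := le_lt_trans (@absS_ge None q (fsubsetP hSR _ hSR0)) q1.
rewrite /= qm ratr_int -intr_norm -[1]/(1%:~R) ltr_int -abszE ltz_nat ltnS leqn0 absz_eq0.
by move=> /eqP m0; move: q0; rewrite qm m0 eqxx.
Qed.

(** The strict bound [T] is rounded down to the value group at each place; [T >= 1] absorbs the
    summand 1 of the count into the factor 3. *)
Lemma S_integer_list (T : R) : 1 <= T -> exists s : seq rat,
  (size s)%:R <= 3 * T ^+ #|` SR| /\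
  forall z, S_integer R SR z -> absS R S z < T -> z \in s.
Proof.
move=> T1; have T0 : 0 < T by apply: lt_le_trans T1.
pose hw (v : SR) := cid (@floor_radius R (val v) T T0).
pose w (v : SR) : R := projT1 (hw v).
have wr (v : SR) : value_radius (val v) (w v) by have [] := projT2 (hw v).
have wT (v : SR) : w v <= T by have [] := projT2 (hw v).
have wx (v : SR) (x : Qv R (val v)) : absv x < T -> absv x <= w v.
  by have [_ _ _] := projT2 (hw v); exact.
have [s [ssize hs]] := S_integer_count hSR0 wr; exists s; split.
  have : \prod_v w v <= T ^+ #|` SR|.
    rewrite cardfE -prodr_const; apply: ler_prod => v _.
    by rewrite wT ltW // (value_radius_gt0 (wr v)).
  have : 1 <= T ^+ #|` SR| by rewrite exprn_ege1.
  by move: ssize; lra.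
move=> z zS zT; apply: hs => // v; rewrite -absv_ratr; apply: wx; rewrite absv_ratr.
by apply: le_lt_trans zT; apply: absS_ge; exact: (fsubsetP hSR _ (valP v)).
Qed.

End SIntegers.

(** A strict upper bound on an infimum is witnessed by a member. The passage between powers and
    their bases requires a positive exponent, hence a nonempty [S]. *)
Lemma dist_ZS_lt (R : realType) (S : {fset place}) (hS : None \in S)
    (y : forall v : S, Qv R (val v)) (e : R) : 0 < e ->
  (dist_ZS y ^+ #|` S| < e ^+ #|` S|) <->
  exists2 z, S_integer R S z & forall v, absv (y v - ratr z) < e.
Proof.
move=> e0; have S0 : (0 < #|` S|)%N by rewrite cardfs_gt0; apply/fset0Pn; exists None.
pose X := [set \big[Num.max/0]_(v : S) absv (y v - ratr z) | z in S_integer R S].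
have X0 : lbound X 0.
  by move=> _ [z _ <-]; elim/big_rec: _ => // i x _ x0; rewrite le_max x0 orbT.
have Xn : X !=set0.
  exists (\big[Num.max/0]_(v : S) absv (y v - ratr 0)), 0 => // v _.
  by case: v => [p|]; rewrite /place_abs ?padic_norm0 ?rmorph0 ?normr0 ler01.
have d0 : 0 <= dist_ZS y by apply: lb_le_inf.
rewrite ltr_pXn2r ?nnegrE ?(ltW e0) //; split.
  move=> /inf_lt[]// _ [z zS <-] hz; exists z => // v.
  by apply: le_lt_trans hz; exact: (le_bigmax 0 (fun v : S => absv (y v - ratr z))).
move=> [z zS hz]; apply: (@le_lt_trans _ _ (\big[Num.max/0]_(v : S) absv (y v - ratr z))).
  by apply: ge_inf; [exists 0|exists z].
by apply: bigmax_lt.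
Qed.

(** * Strips where the gradient is large *)

Section LargeGradient.
Context {R : realType} {S : {fset place}} (hS : None \in S) {d : S -> nat}.
Context (mu_ : forall v : S, {measure set (Qv_borel R (val v)) -> \bar R}).
Context (hmu_ : forall v, is_mu_v (mu_ v)).
Context (mu : {measure set (QSpace_borel R d) -> \bar R}).
Context (hmu : is_product_measure mu_ mu).
Unset Implicit Arguments.
Context (n : nat) (c : forall v : S, 'rV[Qv R (val v)]_(d v)) (r : forall v : S, 'I_(d v) -> R).
Context (f : forall v : S, 'rV[Qv R (val v)]_(d v) -> 'rV[Qv R (val v)]_n).
Set Implicit Arguments.
Local Notation U := (fun v => obox (c v) (r v)).
Hypothesis hdq : forall v (j : 'I_n) (beta : 'I_(d v) -> nat), (\sum_i beta i)%N = 2%N ->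
    let Ui i := oball (c v 0 i) (r v i) in
    exists2 G, is_dq_extension Ui beta (fun x => f v x 0 j) G &
      forall y, dq_dom Ui beta y -> absv (G y) <= 2^-1.

Definition strip (q : 'I_n -> rat) (G : S -> R) (e : R) : set (QSpace R d) :=
  [set x | [/\ forall v, U v (x v),
     exists2 z, S_integer R S z & forall v, absv ((f v (x v) *m qcol q) 0 0 - ratr z) < e &
     forall v, G v < normv (gradient (f v) (x v) *m qcol q)]].

(** All conditions are strict: the same [z] serves nearby points. Openness is the source of
    measurability. *)
Lemma strip_open q G e : (forall v, 0 <= G v) -> QSpace_open (strip q G e).
Proof.
move=> G0 x [Ux [z zS hz] hG].
have /(_ _)/cid2 hA (v : S) := normv_gt_open (G0 v) (hG v).
pose g v := s2val (hA v).
have g0 v : 0 < g v := s2valP (hA v).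
pose gap v := Num.min (g v) (e - absv ((f v (x v) *m qcol q) 0 0 - ratr z)).
have gap0 v : 0 < gap v by rewrite lt_min g0 subr_gt0 hz.
have /(_ _)/cid2 hB (v : S) := lform_open (@hdq v) (qcol q) (Ux v) (gap0 v).
have [t t0 ht] := @finite_lower_bound R S (fun v => s2val (hB v)) (fun v => s2valP (hB v)).
exists t => // y yx.
have hy v := s2valP' (hB v) _ (lt_le_trans (yx v) (ht v)).
split.
- by move=> v; have [] := hy v.
- exists z => // v; have [_ + _] := hy v; rewrite lt_min => /andP[_ h].
  by apply: le_lt_trans (absv_split ((f v (x v) *m qcol q) 0 0) _ _) _; lra.
- move=> v; apply: (s2valP' (hA v)) => i j; rewrite ord1; have [_ _ /(_ i)] := hy v.
  by rewrite lt_min => /andP[].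
Qed.


(** Replaces the open box by a closed one of the same measure with radii in the value groups, as the
    grids require. *)
Lemma obox_volume : (forall v i, 0 < r v i) -> exists w : forall v : S, 'I_(d v) -> R,
  [/\ forall v i, value_radius (val v) (w v i),
      [set x : QSpace R d | forall v, U v (x v)] `<=` box c w &
      mu [set x : QSpace R d | forall v, U v (x v)] = (vol w)%:E].
Proof.
move=> r0; pose hw v i := cid (@oball_cell R (val v) (r v i) (r0 v i)).
exists (fun v i => projT1 (hw v i)); split=> [v i|x Ux v i|].
- by have [] := projT2 (hw v i).
- by have [_ _ sub _] := projT2 (hw v i); apply: sub; exact: Ux.
have := hmu (fun v i => measurable_oball (c v 0 i) (r v i)) => ->.
rewrite /vol -prodEFin; apply: eq_bigr => v _; rewrite -prodEFin; apply: eq_bigr => i _.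
by have [_ _ _] := projT2 (hw v i); apply; exact: hmu_.
Qed.

Lemma strip_bound (SR : {fset place}) (eps : R) :
  (0 < n)%N -> (forall v, (0 < d v)%N) -> (forall v i, 0 < r v i) ->
  None \in SR -> 0 < eps -> eps * (4 * #|` S|%:R) <= 1 ->
  exists2 N0 : R, 1 <= N0 & forall (q : 'I_n -> rat) (e : R),
  let N := normS R S q in let G v := if val v \in SR then N `^ (1 - eps) else N `^ (- eps) in
  (forall k, S_integer R SR (q k)) -> N0 <= N -> 0 < e -> e ^+ #|` S| <= n%:R / N ->
  (mu (strip q G e) <=
    (108 * e ^+ #|` S|)%:E * mu [set x : QSpace R d | forall v, U v (x v)])%E.
Proof.
move=> n0 d0 r0 SR0 eps0 epsS; have [w [wr Uw ->]] := obox_volume r0.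
set s := #|` S|.
have s0 : (0 < s)%N by rewrite cardfs_gt0; apply/fset0Pn; exists None.
have w0 v i : 0 < w v i := value_radius_gt0 (wr v i).
have [t t0 ht] := @finite_lower_bound R {v : S & 'I_(d v)} (fun p => w (tag p) (tagged p))
  (fun p => w0 _ _).
have {}ht v i : t <= w v i by exact: (ht (existT (fun v : S => 'I_(d v)) v i)).
pose dd := (\sum_v d v)%N; pose bb := (\sum_(v : S) place_base (val v))%N.
have ddle v : (d v <= dd)%N by rewrite /dd (bigD1 v) //= leq_addr.
have bble (v : S) : (place_base (val v) <= bb)%N by rewrite /bb (bigD1 v) //= leq_addr.
pose vN : S := [` hS]%fset.
have dd0 : 0 < dd%:R :> R by rewrite ltr0n (leq_trans (d0 vN)).
have bb0 : 0 < bb%:R :> R by rewrite ltr0n (leq_trans _ (bble vN)).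
have dv0 v : 0 < (d v)%:R :> R by rewrite ltr0n.
have bv0 (v : S) : 0 < (place_base (val v))%:R :> R := place_base_gt0 (val v).
have nR0 : 0 < n%:R :> R by rewrite ltr0n.
(* Chosen so that the gradient varies by at most half of [g v] over a box of side [c0 * Ne]; [dd]
   and [bb] bound the dimensions and the bases at all places at once. *)
pose c0 : R := (4 * n%:R * dd.+1%:R * dd%:R)^-1.
have c00 : 0 < c0 by rewrite invr_gt0 !mulr_gt0 // ltr0Sn.
pose k0 : R := c0 / (dd%:R * bb%:R).
have k00 : 0 < k0 by rewrite divr_gt0 // mulr_gt0.
(* [N1] makes [rho] fit into the box at every coordinate; [N2] serves the estimate [key]. *)
have [N1 N11 hN1] := powR_unbounded (c0 / t) eps0.
have [N2 N21 hN2] := @powR_unbounded R (n%:R / k0 ^+ s) 2^-1 ltac:(by rewrite invr_gt0).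
exists (Num.max N1 N2); first by rewrite le_max N11.
move=> q e N G qS; rewrite ge_max => /andP[NN1 NN2] e0 eN.
have N_ge1 : 1 <= N by apply: le_trans NN1.
have N0 : 0 < N by apply: lt_le_trans N_ge1.
pose Ne := N `^ (- eps).
have Ne0 : 0 < Ne by exact: powR_gt0.
(* Outside [SR] the entries of [q] are integral at [v], hence the bound 1. *)
pose H (v : S) := if val v \in SR then N else 1.
have H1 v : 1 <= H v by rewrite /H; case: ifP.
have H0 v : 0 < H v by apply: lt_le_trans (H1 v).
have GE v : G v = H v * Ne.
  rewrite /G /H; case: ifP => _; last by rewrite mul1r.
  by rewrite powRD ?powRr1 ?(ltW N0) // (gt_eqF N0) implybT.
have qH (v : S) k : absv (@qcol R (val v) n q k 0) <= H v.
  rewrite /H; case: ifP => vSR.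
    apply: le_trans (absv_le_normv _ k 0) _.
    exact: (le_bigmax 0 (fun v : S => normv (@qcol R (val v) n q))).
  by rewrite mxE absv_ratr; apply: qS; rewrite vSR.
pose rho := c0 * Ne.
have rho0 : 0 < rho by rewrite mulr_gt0.
pose g v := G v / (d v)%:R.
have g0 v : 0 < g v by rewrite divr_gt0 // GE mulr_gt0.
(* The right side has the order of [N] to the power [- 2 * eps * s], and this exponent is at least
   -1/2 by the bound on [eps]. *)
have key : n%:R / N <= (k0 * Ne ^+ 2) ^+ s.
  rewrite exprMn -exprM -[Ne ^+ _]powR_mulrn ?(ltW Ne0) // -powRrM.
  apply: (@le_trans _ _ (k0 ^+ s * N `^ (- 2^-1))); last first.
    rewrite ler_pM2l ?exprn_gt0 // ler_powR // mulNr lerN2 natrM.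
    move: epsS; rewrite -/s; lra.
  have -> : N `^ (- 2^-1) = N `^ 2^-1 / N.
    rewrite -[X in _ / X]powRr1 ?(ltW N0) // -powRN -powRD; last first.
      by rewrite (gt_eqF N0) implybT.
    by congr (_ `^ _); lra.
  rewrite mulrA ler_pM2r ?invr_gt0 // mulrC -ler_pdivrMr ?exprn_gt0 //.
  exact: hN2.
have gk (v : S) : H v * (k0 * Ne ^+ 2) <= g v * (rho / (place_base (val v))%:R).
  rewrite /g GE /rho /k0 expr2 -!mulrA ler_pM2l //.
  rewrite [leRHS](_ : _ = c0 * (Ne * Ne) * ((d v)%:R * (place_base (val v))%:R)^-1); last first.
    by rewrite invfM; ring.
  rewrite [leLHS](_ : _ = c0 * (Ne * Ne) * (dd%:R * bb%:R)^-1); last by rewrite invfM; ring.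
  rewrite ler_pM2l ?mulr_gt0 // lef_pV2 ?posrE ?mulr_gt0 //.
  by apply: ler_pM => //; rewrite ler_nat.
have kN0 : 0 <= k0 * Ne ^+ 2 by rewrite mulr_ge0 ?exprn_ge0 // ltW.
have G0 v : 0 <= G v by rewrite GE mulr_ge0 // ltW.
rewrite -EFinM.
apply: (@strip_measure R S hS d mu_ hmu_ mu hmu (fun v x => (f v x *m qcol q) 0 0) e e0
  (fun v => U v) (fun v x j => (gradient (f v) x *m qcol q) j 0)
  (fun v => n%:R * H v * (d v).+1%:R) g (fun=> rho) _ _ _ _ _ _ _ _ _ c w).
- by move=> v; rewrite !mulr_ge0 // ltW.
- exact: g0.
- by [].
- move=> v x0 x y u U0 Ux Uy hx hy.
  exact: (lform_approx (@hdq v) (@qH v) U0 Ux Uy hx hy).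
- move=> v; rewrite /g GE -!mulrA mulrCA ler_pM2l // /rho.
  rewrite mulrCA [leLHS](_ : _ = Ne * (2 * (n%:R * ((d v).+1%:R * c0)))); last by ring.
  rewrite ler_pM2l // -invfM -[leRHS]mul1r ler_pdivlMr ?mulr_gt0 //.
  rewrite [leLHS](_ : _ = (4 * n%:R * (d v).+1%:R * (d v)%:R) * c0); last by ring.
  rewrite /c0 ler_pdivrMr ?mul1r; last by rewrite !mulr_gt0.
  by rewrite -!natrM ler_nat; do !apply: leq_mul => //; rewrite ltnS.
- move=> v; apply: le_trans (gk v).
  apply: (@le_trans _ _ (k0 * Ne ^+ 2)); last by rewrite ler_peMl.
  by rewrite -(@ler_pXn2r _ s) ?nnegrE ?(ltW e0) //; exact: le_trans eN key.
- apply: (@le_trans _ _ (\prod_v (H v * (k0 * Ne ^+ 2)))); last first.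
    by apply: ler_prod => v _; rewrite gk mulr_ge0 // ltW.
  rewrite big_split /= prodr_const -cardfE -/s.
  (* The real place lies in [SR] and contributes [N]; every other factor is at least 1. *)
  have HN : N <= \prod_v H v.
    rewrite (bigD1 vN) //= {1}/H SR0 ler_peMr ?(ltW N0) //.
    by elim/big_ind: _ => // x y; exact: mulr_ege1.
  apply: (@le_trans _ _ (N * (n%:R / N))).
    by rewrite mulrC divfK ?gt_eqF // ler1n.
  by apply: ler_pM => //; rewrite ?divr_ge0 // ltW.
- by apply: measurable_QSpace_open; exact: strip_open.
- by [].
- move=> v i; apply: le_trans (ht v i); rewrite /rho /Ne powRN.
  by rewrite ler_pdivrMr ?powR_gt0 // mulrC -ler_pdivrMr //; exact: hN1.
- by move=> x [Ux _ _]; exact: Uw.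
- by move=> x [].
- by move=> x [_ _ hG] v; exact: normv_col_gt.
- by move=> x [_ hz _].
Qed.

End LargeGradient.

Lemma place_abs0 (R : realType) (v : place) : place_abs R v 0 = 0.
Proof. by case: v => [p|]; rewrite /place_abs ?padic_norm0 // rmorph0 normr0. Qed.

Lemma absS_eq0 (R : realType) (S : {fset place}) (hS : None \in S) (q : rat) :
  q = 0 -> absS R S q = 0.
Proof.
move=> ->; apply/eqP; rewrite eq_le (le_trans _ (absS_ge _ hS)) ?place_abs0 // andbT.
by apply: bigmax_le => // v _; rewrite place_abs0.
Qed.

Theorem theorem1p2 (R : realType) (n : nat) (hn : (1 <= n)%N) :
  exists C : R,
  forall (S : {fset place}) (hS : None \in S)
    (d : S -> nat) (hd : forall v, (1 <= d v)%N)
    (mu_ : forall v : S, {measure set (Qv_borel R (val v)) -> \bar R})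
    (hmu_ : forall v, is_mu_v (mu_ v))
    (mu : {measure set (QSpace_borel R d) -> \bar R})
    (hmu : is_product_measure mu_ mu)
    (c : forall v : S, 'rV[Qv R (val v)]_(d v)) (r : forall v : S, 'I_(d v) -> R)
    (hr : forall v i, 0 < r v i)
    (f : forall v : S, 'rV[Qv R (val v)]_(d v) -> 'rV[Qv R (val v)]_n),
  let U v := obox (c v) (r v) in
  let bigU := [set x : QSpace R d | forall v, U v (x v)] in
  (forall v, analytic_on (U v) (f v)) ->
  (forall v, extends_to_boundary (U v) (f v)) ->
  (forall v, independent_with_1 (U v) (f v)) ->
  (forall v x, U v x -> normv (f v x) <= 1) ->
  (forall v x, U v x -> normv (gradient (f v) x) <= 1) ->
  (forall v (j : 'I_n) (beta : 'I_(d v) -> nat), (\sum_i beta i)%N = 2%N ->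
    let Ui i := oball (c v 0 i) (r v i) in
    exists2 G, is_dq_extension Ui beta (fun x => f v x 0 j) G &
      forall y, dq_dom Ui beta y -> absv (G y) <= 2^-1) ->
  forall (SR : {fset place}) (hSR : (SR `<=` S)%fset) (hSR0 : None \in SR)
    (eps : R) (heps0 : 0 < eps),
  eps < (4 * n%:R * (#|` S|)%:R * (1 + (#|` (S `\` SR)%fset|)%:R))^-1 ->
  exists T0 : R,
  forall (delta : R) (T : 'I_n -> R), 0 < delta -> (forall i, 0 < T i) ->
  T0 < \big[Num.max/0]_i T i ->
  let A := [set x : QSpace R d | bigU x /\ exists q : 'I_n -> rat,
    [/\ forall i, q i \in S_integer R SR,
        forall i, T i / 2 <= absS R S (q i) < T i,
        dist_ZS (fun v : S => (f v (x v) *m qcol q) 0 0) ^+ #|` S|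
          < delta * (\prod_i T i) ^- #|` SR|,
        forall v : S, val v \notin SR ->
          normv (gradient (f v) (x v) *m qcol q) > normS R S q `^ (- eps) &
        forall v : S, val v \in SR ->
          normv (gradient (f v) (x v) *m qcol q) > normS R S q `^ (1 - eps)]] in
  (mu A < (C * delta)%:E * mu bigU)%E.

Proof.
(* 108 from one strip and 3 for each entry of [q]; 109 instead of 108 gives the strict
   inequality. *)
exists (109 * 3 ^+ n).
move=> S hS d hd mu_ hmu_ mu hmu c r hr f U bigU _ _ _ _ _ hdq SR hSR hSR0 eps heps0 heps.
set s := #|` S|; set g := #|` SR|.
have s0 : (0 < s)%N by rewrite cardfs_gt0; apply/fset0Pn; exists None.
have g0 : (0 < g)%N by rewrite cardfs_gt0; apply/fset0Pn; exists None.
have sR0 : 0 < s%:R :> R by rewrite ltr0n.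
have nR1 : 1 <= n%:R :> R by rewrite ler1n.
have epsS : eps * (4 * s%:R) <= 1.
  rewrite -ler_pdivlMr ?mulr_gt0 // mul1r; apply: le_trans (ltW heps) _.
  set k : R := (#|` (S `\` SR)%fset|)%:R.
  have k1 : 1 <= n%:R * (1 + k) by rewrite mulr_ege1 // lerDl ler0n.
  rewrite (_ : 4 * n%:R * s%:R * (1 + k) = 4 * s%:R * (n%:R * (1 + k))); last by ring.
  have s4 : 0 < 4 * s%:R :> R by rewrite mulr_gt0.
  by rewrite lef_pV2 ?posrE ?(mulr_gt0 s4 (lt_le_trans ltr01 k1)) // ler_peMr // ltW.
have [N0 N01 hN0] := strip_bound hS hmu_ hmu hdq hn hd hr hSR0 heps0 epsS.
have [w [wr Uw UE]] := obox_volume hmu_ hmu c hr.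
have w0 v i : 0 < w v i := value_radius_gt0 (wr v i).
set V := vol w in UE; have V0 : 0 < V by exact: vol_gt0.
(* Some entry of [q] has size at least half of the largest [T i], so the norm of [q] is at least
   [N0]. *)
exists (2 * N0) => delta T delta0 T0 Tlarge; cbv zeta.
set A := [set x : QSpace R d | bigU x /\ _].
rewrite /bigU UE -EFinM.
set C := 109 * 3 ^+ n; have C1 : 1 <= C by rewrite mulr_ege1 ?exprn_ege1 ?ler1n.
pose P := \prod_i T i; have P0 : 0 < P by apply: prodr_gt0 => i _.
pose y := delta * P ^- g; have y0 : 0 < y by rewrite mulr_gt0 // invr_gt0 exprn_gt0.
pose e := y `^ s%:R^-1; have e0 : 0 < e by exact: powR_gt0.
have es : e ^+ s = y.
  by rewrite -powR_mulrn ?(ltW e0) // -powRrM mulVf ?gt_eqF // powRr1 // ltW.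
pose G (q : 'I_n -> rat) (v : S) : R := if val v \in SR then normS R S q `^ (1 - eps) else normS R S q `^ (- eps).
have G0 q v : 0 <= G q v by rewrite /G; case: ifP => _; exact: powR_ge0.
pose adm (q : 'I_n -> rat) := (forall i, S_integer R SR (q i)) /\
  (forall i, T i / 2 <= absS R S (q i) < T i).
have AE x : A x <-> exists2 q, adm q & strip c r f q (G q) e x.
  split.
    move=> [Ux [q [qS qT hd1 hG1 hG2]]]; exists q.
      by split=> // i; exact: set_mem (qS i).
    split=> //; first by apply/(dist_ZS_lt hS _ e0); rewrite -/s es.
    by move=> v; rewrite /G; case: ifP => vSR; [exact: hG2|exact: hG1 (negbT vSR)].
  move=> [q [qS qT] [Ux hz hG]]; split=> //; exists q; split=> //.
  - by move=> i; exact: mem_set (qS i).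
  - by have /(dist_ZS_lt hS _ e0) := hz; rewrite -/s es.
  - by move=> v vSR; have := hG v; rewrite /G (negbTE vSR).
  - by move=> v vSR; have := hG v; rewrite /G vSR.
have mA : measurable (A : set (QSpace_borel R d)).
  apply: measurable_QSpace_open => x /AE[q aq xq].
  have [t t0 ht] := strip_open hdq (G0 q) xq; exists t => // z zx.
  by apply/AE; exists q => //; exact: ht.
have AV : (mu A <= V%:E)%E.
  rewrite -(box_measure hmu_ hmu c wr); apply: le_measure; rewrite ?inE //.
    exact: measurable_box.
  by move=> x [Ux _]; exact: Uw.
(* For large [delta] the whole box is small enough; otherwise [delta <= 1], which bounds [e] in
   terms of the norm of [q]. *)
have [Cd|Cd] := ltP 1 (C * delta).
  by apply: le_lt_trans AV _; rewrite lte_fin ltr_pMl.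
have delta1 : delta <= 1 by apply: le_trans Cd; rewrite ler_peMl // ltW.
(* A point of [A] supplies an admissible [q]; its entries are nonzero, which forces [T i >= 1]. *)
have [[x0 Ax0]|A0] := pselect (exists x, A x); last first.
  have -> : A = set0 by apply/seteqP; split=> x // Ax; case: A0; exists x.
  by rewrite measure0 lte_fin !mulr_gt0 // exprn_gt0.
have T1 i : 1 <= T i.
  have [_ [q [qS qT _ _ _]]] := Ax0; have /andP[qT1 qT2] := qT i.
  apply: le_trans (ltW qT2); apply: (@S_integer_absS_ge1 R S SR hSR hSR0 (q i)); last exact: set_mem (qS i).
  apply/negP => /eqP q0; move: qT1; rewrite (absS_eq0 _ hS q0) leNgt.
  by rewrite divr_gt0.
have hs i := cid (S_integer_list hSR hSR0 (T1 i)).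
pose L := choices [seq projT1 (hs i) | i <- enum 'I_n].
pose ql (l : seq rat) (i : 'I_n) : rat := nth 0 l i.
(* The product list also contains vectors that are not admissible; their sets are empty. *)
pose E (l : seq rat) : set (QSpace_borel R d) :=
  [set x | adm (ql l) /\ strip c r f (ql l) (G (ql l)) e x].
have PT i : T i <= P.
  rewrite /P (bigD1 i) //= ler_peMr ?(ltW (T0 i)) //.
  by elim/big_ind: _ => // a b; exact: mulr_ege1.
have P1 : 1 <= P by exact: le_trans (T1 (Ordinal hn)) (PT _).
have mE l : measurable (E l).
  have [al|nal] := pselect (adm (ql l)).
    have -> : E l = strip c r f (ql l) (G (ql l)) e by apply/seteqP; split=> x // [].
    by apply: measurable_QSpace_open; exact: strip_open.
  by have -> : E l = set0 by apply/seteqP; split=> x // [].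
have Vy0 : 0 <= 108 * y * V by rewrite mulr_ge0 ?(ltW V0) // mulr_ge0 // (ltW y0).
have hE l : (mu (E l) <= (108 * y * V)%:E)%E.
  have [[qS qT]|nal] := pselect (adm (ql l)); last first.
    have -> : E l = set0 by apply/seteqP; split=> x // [].
    by rewrite measure0 lee_fin.
  have -> : E l = strip c r f (ql l) (G (ql l)) e by apply/seteqP; split=> x // [].
  set q := ql l in qS qT *.
  have absN i : absS R S (q i) <= normS R S q.
    apply: bigmax_le => [|v _].
      by apply: le_trans (le_bigmax 0 _ [` hS]%fset); exact: normv_ge0.
    apply: le_trans (le_bigmax 0 _ v); rewrite -absv_ratr.
    by have := absv_le_normv (@qcol R (val v) n q) i 0; rewrite mxE.
  have NN0 : N0 <= normS R S q.
    have [i Ti] : exists i, 2 * N0 < T i.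
      apply/not_existsP => h; move: Tlarge; apply/negP; rewrite -leNgt.
      apply: bigmax_le; first by rewrite mulr_ge0 // (le_trans ler01).
      by move=> i _; rewrite leNgt; apply/negP/h.
    by apply: le_trans (absN i); have /andP[+ _] := qT i; lra.
  have Npos : 0 < normS R S q by apply: lt_le_trans NN0; apply: lt_le_trans N01.
  have := hN0 q e qS NN0 e0; rewrite UE -EFinM -/s es; apply.
  (* Every [T i] is at most [P], as the other factors are at least 1. Hence [y <= P^-1 <= n / N],
     the bound on [e] that [strip_bound] requires. *)
  have NP : normS R S q <= n%:R * P.
    apply: bigmax_le => [|v _]; first by rewrite mulr_ge0 // ltW.
    apply: le_trans (normv_le_sum _) _.
    rewrite mulr_natl -[X in _ *+ X]card_ord -sumr_const; apply: ler_sum => i _.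
    rewrite big_ord1 mxE absv_ratr; apply: le_trans (absS_ge _ (valP v)) _.
    by have /andP[_ /ltW qTi] := qT i; exact: le_trans qTi (PT i).
  apply: (@le_trans _ _ P^-1).
    apply: (@le_trans _ _ (P ^- g)).
      by rewrite /y ler_piMl // invr_ge0 exprn_ge0 // ltW.
    by rewrite lef_pV2 ?posrE ?exprn_gt0 // ler_eXnr.
  by rewrite ler_pdivlMr // mulrC ler_pdivrMr.
have cov : (mu A <= \sum_(l <- L) mu (E l))%E.
  apply: measure_le_sum => // x /AE[q aq xq].
  have qE : ql [seq q i | i <- enum 'I_n] = q.
    apply/funext => i; rewrite /ql (nth_map i) ?size_enum_ord ?ltn_ord //.
    by rewrite nth_ord_enum.
  exists [seq q i | i <- enum 'I_n]; last by rewrite /E /= qE.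
  apply: mem_choices => i _; have [_ hsi] := projT2 (hs i); apply: hsi; first by case: aq.
  by have [_ /(_ i)/andP[]] := aq.
apply: (le_lt_trans cov).
apply: (@le_lt_trans _ _ (\sum_(l <- L) (108 * y * V)%:E)%E); first exact: lee_sum.
rewrite sumEFin lte_fin big_const_seq count_predT iter_addr_0 -[X in X < _]mulr_natl.
have Lsize : (size L)%:R <= 3 ^+ n * P ^+ g.
  rewrite size_choices big_map big_enum natr_prod /=.
  apply: (@le_trans _ _ (\prod_(i < n) (3 * T i ^+ g))).
    by apply: ler_prod => i _; rewrite ler0n; have [] := projT2 (hs i).
  by rewrite big_split /= prodr_const card_ord prodrXl.
apply: le_lt_trans (ler_wpM2r Vy0 Lsize) _.
(* The number of vectors cancels the power of [P] in [y]. *)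
have -> : 3 ^+ n * P ^+ g * (108 * y * V) = 108 * (3 ^+ n * (delta * V)).
  by rewrite /y; field; rewrite expf_neq0 // gt_eqF.
rewrite /C -!mulrA ltr_pM2r ?mulr_gt0 ?exprn_gt0 //.
by rewrite ltr_nat.
Qed.
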